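(* Let $q$ be a power of an odd prime, let $n\ge3$ be odd, and let $f\in\mathbb{F}_q[x_1,\dots,x_n]$ be a non-degenerate quadratic form. Let $X=V(f)\subseteq\mathbb{P}^{n-1}$. Then for every integer $P\ge1$: if $n=3$, $$\#\mathrm{Mor}_P(\mathbb{P}^1,X)(\mathbb{F}_q)=\begin{cases}\frac{q^2-1}{q}\,q^{P}&\text{if }2\mid P,\\0&\text{if }2\nmid P,\end{cases}$$ and if $n\ge5$, $$\#\mathrm{Mor}_P(\mathbb{P}^1,X)(\mathbb{F}_q)=\begin{cases}\frac{(q^{n-1}-1)(q^{n-2}-1)}{q^{n-2}(q-1)}\,q^{P(n-2)}&\text{if }2\mid P,\\ \frac{(q^{n-1}-1)(q^{n-2}-1)}{q^{n-2}(q-1)}\,q^{P(n-2)}-\frac{q^{n-1}-1}{q^{(n-1)/2}}\,q^{\frac{n-1}{2}P}&\text{if }2\nmid P.\end{cases}$$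
   Context: Non-degenerate means the symmetric matrix $A$ with $f(\mathbf{x})=\mathbf{x}^TA\mathbf{x}$ has nonzero determinant. $\#\mathrm{Mor}_P(\mathbb{P}^1,X)(\mathbb{F}_q)$ denotes the number of morphisms $\mathbb{P}^1\to X$ of degree exactly $P$ defined over $\mathbb{F}_q$; equivalently, it is the number of vectors $(x_1,\dots,x_n)\in\mathbb{F}_q[t]^n$ with $\gcd(x_1,\dots,x_n)=1$, $\max_i\deg(x_i)=P$ and $f(x_1,\dots,x_n)=0$, counted modulo multiplication by scalars in $\mathbb{F}_q^\times$ (i.e. this number divided by $q-1$). *)

(* Defs.v *)
From HB Require Import structures.
From mathcomp Require Import all_boot all_order all_algebra all_field.
Set Implicit Arguments. Unset Strict Implicit. Unset Printing Implicit Defensive.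
Import Order.TTheory GRing.Theory Num.Theory.
Local Open Scope ring_scope.

Definition qform_eval (F : fieldType) (n : nat) (A : 'M[F]_n)
  (x : 'I_n -> {poly F}) : {poly F} :=
  \sum_(i < n) \sum_(j < n) x i * (A i j)%:P * x j.

(* gcd(x_1,...,x_n) = 1 (gcd of polynomials is defined up to units) *)
Definition coprime_vec (F : fieldType) (n : nat) (x : 'I_n -> {poly F}) : bool :=
  (\big[@gcdp F/0]_(i < n) x i) %= 1.

(* max_i deg x_i = P, with deg = size - 1 (for P >= 1 this is max size = P+1) *)
Definition maxdeg_eq (F : fieldType) (n : nat) (x : 'I_n -> {poly F}) (P : nat) : bool :=
  (\max_(i < n) size (x i) == P.+1)%N.

(* The set of vectors (x_1..x_n) in F[t]^n with coprime entries, max degree P,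
   and f(x)=0. Polynomials with max degree P all live in {poly_(P+1) F}
   (polynomials of size <= P+1), a finite type. *)
Definition mor_vectors (F : finFieldType) (n : nat) (A : 'M[F]_n) (P : nat)
  : {set {ffun 'I_n -> {poly_P.+1 F}}} :=
  [set x : {ffun 'I_n -> {poly_P.+1 F}} |
     let y := fun i => (x i : {poly F}) in
     [&& coprime_vec y, maxdeg_eq y P & qform_eval A y == 0]].

Definition num_mor (F : finFieldType) (n : nat) (A : 'M[F]_n) (P : nat) : rat :=
  (#|mor_vectors A P|)%:R / (#|F| - 1)%:R.

(* Main.v *)
(* The coefficients of f(x), for x a vector of polynomials of degree < m, are
   2m-1 quadratic forms in the coefficients of x.  Averaging over all linear
   combinations s of these coefficients expresses the number of solutions
   through the biases of the forms H_s (x) A, where H_s is the m x m Hankel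
   matrix of s.  Splitting hyperbolic planes off A gives
   bias (H_s (x) A) = q^(- rank H_s * (n-1)/2) * bias H_s, so only the sums
   S(m, r) of bias H_s over the s with rank H_s = r are needed.  These vanish
   for odd r.  For r < m they do not depend on m: counting pairs (s, u) with u
   in the kernel of a rectangular Hankel matrix of s reduces this to counting
   x with u | x^2, whose dependence on the degree bound is plain.  Finally the
   trivial case n = 1, where x^2 = 0 has a single solution, yields
   sum_r S(m, r) = q^(m-1), which is enough to get a two-term recurrence in m
   for the number of solutions.  Dividing out the monic gcd does the rest. *)
Require Import Defs.
From HB Require Import structures.
From mathcomp Require Import all_boot all_order all_algebra all_field.
From mathcomp Require Import mxabelem qpoly ring zify.
Set Implicit Arguments. Unset Strict Implicit. Unset Printing Implicit Defensive.
Import Order.TTheory GRing.Theory Num.Theory.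
Local Open Scope ring_scope.

(** * Counting over a finite field of odd order *)

Section Counting.
Variable F : finFieldType.
Local Notation q := (#|F|).

Lemma card_left_kernel n k (A : 'M[F]_(n, k)) :
  #|[set u : 'rV[F]_n | u *m A == 0]| = (q ^ (n - \rank A))%N.
Proof.
rewrite -mxrank_ker -card_rowg; apply: eq_card => u.
by rewrite inE mem_rowg sub_kermx.
Qed.

Lemma card_right_kernel n k (A : 'M[F]_(k, n)) :
  #|[set u : 'cV[F]_n | A *m u == 0]| = (q ^ (n - \rank A))%N.
Proof.
rewrite -mxrank_tr -card_left_kernel -(card_imset _ (@trmx_inj F n 1)).
apply: eq_card => u; rewrite inE; apply/imsetP/eqP => [[v + ->]|uA].
  by rewrite inE -trmx_mul => /eqP->; rewrite trmx0.
by exists u^T; rewrite ?trmxK// inE -[A]trmxK -trmx_mul uA trmx0.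
Qed.

(** For [c != 0] the solutions form a translate of the kernel of [c]. The factor [q] on the left
    keeps the exponent [m - 1] out of the statement. *)
Lemma card_affine_hyperplane m (c : 'rV[F]_m) (d : F) :
  (q * #|[set y : 'cV[F]_m | (\tr (c *m y) + d == 0)%R]| =
   if c == 0%R then (d == 0%R) * q ^ m.+1 else q ^ m)%N.
Proof.
case: eqP => [->|/eqP c0].
  under eq_finset => y do rewrite mul0mx mxtrace0 add0r.
  case: (d == 0); last by rewrite cards0 muln0.
  by rewrite cardsT card_mx muln1 mul1n expnS.
have rc : \rank c = 1%N by rewrite rank_rV c0.
have m0 : (0 < m)%N by rewrite -rc rank_leq_col.
have [y0 cy0] : exists y0, c *m y0 = (- d)%:M.
  have /row_freeP[y cy] : row_free c by rewrite /row_free rc.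
  by exists (- d *: y); rewrite -scalemxAr cy scalemx1.
suff -> : #|[set y : 'cV[F]_m | (\tr (c *m y) + d == 0)%R]| =
          #|[set u : 'cV[F]_m | c *m u == 0]|.
  by rewrite card_right_kernel rc -expnS subn1 prednK.
rewrite -[RHS](card_imset _ (addrI y0)); apply: eq_card => y; rewrite inE.
apply/eqP/imsetP => [yd|[u + ->]].
  exists (y - y0); rewrite ?subrKC// inE mulmxBr cy0.
  rewrite [c *m y]mx11_scalar -raddfB/= opprK.
  by move: yd; rewrite trace_mx11 => ->; rewrite raddf0.
by rewrite inE mulmxDr cy0 => /eqP->; rewrite addr0 mxtrace_scalar mulr1n addNr.
Qed.

Definition form_zeros m n (H : 'M[F]_m) (A : 'M[F]_n) : nat :=
  #|[set X : 'M[F]_(m, n) | \tr (X *m A *m X^T *m H) == 0]|.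

(* The average of psi (c * Q(X)) over all X and all nonzero scalars c, where psi
   is any nontrivial additive character of F and Q(X) = tr (X A X^T H). *)
Definition form_bias m n (H : 'M[F]_m) (A : 'M[F]_n) : rat :=
  (q%:R * (form_zeros H A)%:R - q%:R ^+ (m * n)) / ((q%:R - 1) * q%:R ^+ (m * n)).

Lemma qr_neq0 : q%:R != 0 :> rat.
Proof. by rewrite pnatr_eq0 -lt0n ltnW ?finNzRing_gt1. Qed.

Lemma qr1_neq0 : q%:R - 1 != 0 :> rat.
Proof. by rewrite subr_eq0 pnatr_eq1 gtn_eqF ?finNzRing_gt1. Qed.
#[local] Hint Resolve qr_neq0 qr1_neq0 : core.

Hypothesis q_odd : odd q.

Lemma two_neq0 : 2%:R != 0 :> F.
Proof.
apply/negP => /eqP two0.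
have p2 : 2 \in [pchar F] by rewrite inE /= two0 eqxx.
move: q_odd (finNzRing_gt1 F); rewrite (card_pprimeChar p2) oddX /= orbF.
by move=> /eqP->.
Qed.

Lemma card_pair_le2 (T : finType) (x y : T) : (#|[set x; y]| <= 2)%N.
Proof. by rewrite cards2; case: (x != y). Qed.

(** Pigeonhole: [a * x ^+ 2] and [d - b * y ^+ 2] each take more than [q / 2] values, so they share
    one. *)
Lemma binary_form_onto (a b d : F) : a != 0 -> b != 0 ->
  exists x y, a * x ^+ 2 + b * y ^+ 2 = d.
Proof.
move=> a0 b0.
(* The fibres are of the form [{x, -x}], which gives [q <= 2 * #|S|]; equality is excluded because
   [q] is odd. *)
have big_image (c e : F) : c != 0 -> (q < 2 * #|[set (c * x ^+ 2 + e)%R | x : F]|)%N.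
  move=> c0; set S := [set _ | x : F].
  have le : (q <= 2 * #|S|)%N.
    rewrite -(sum1_card F) (partition_big_imset (fun x => c * x ^+ 2 + e)) /=.
    rewrite mulnC -sum_nat_const; apply: leq_sum => z /imsetP[x _ ->].
    rewrite sum1_card (leq_trans _ (card_pair_le2 x (- x))) // subset_leq_card //.
    apply/subsetP => y; rewrite !inE => /eqP/addIr/(mulfI c0)/eqP.
    by rewrite eqf_sqr.
  rewrite ltn_neqAle le andbT; apply: contraL q_odd => /eqP->.
  by rewrite mul2n odd_double.
pose S : {set F} := [set (a * x ^+ 2 + 0) | x : F].
pose T : {set F} := [set (- b * y ^+ 2 + d) | y : F].
have /set0Pn[z /setIP[/imsetP[x _ zx] /imsetP[y _ zy]]] : S :&: T != set0.
  have arith u s t i r : (r < 2 * s -> r < 2 * t -> u <= r -> u + i = s + t -> 0 < i)%N.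
    by lia.
  rewrite -card_gt0; apply: (arith _ _ _ _ q _ _ _ (cardsUI S T)); last exact: max_card.
  - exact: big_image.
  - by apply: big_image; rewrite oppr_eq0.
exists x, y.
have -> : a * x ^+ 2 = - b * y ^+ 2 + d by rewrite -[LHS]addr0 -zx.
by ring.
Qed.

Lemma exists_left_null n k (D : 'M[F]_(n, k)) : (k < n)%N ->
  exists2 v : 'rV[F]_n, v != 0 & v *m D = 0.
Proof.
move=> ltkn; have /rowV0Pn[v /sub_kermxP vD v0] : kermx D != 0; last by exists v.
rewrite kermx_eq0 /row_free; apply: contraTneq ltkn => <-.
by rewrite -leqNgt rank_leq_col.
Qed.

(** Three pairwise orthogonal nonzero vectors are built one after the other. If none is isotropic,
    the form is diagonal on them and [binary_form_onto] solves [a x^2 + b y^2 = - c]. *)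
Lemma exists_isotropic n (A : 'M[F]_n) : (3 <= n)%N -> A^T = A ->
  exists2 v : 'rV[F]_n, v != 0 & v *m A *m v^T = 0.
Proof.
move=> n3 symA.
have orthC (u v : 'rV[F]_n) : v *m (A *m u^T) = 0 -> u *m A *m v^T = 0.
  by move=> /(congr1 trmx); rewrite !trmx_mul symA trmxK trmx0.
have [n1 n2] : (0 < n)%N /\ (1 < n)%N by lia.
have [v1 v1_0 _] := exists_left_null (0 : 'M_(n, 0)) n1.
have [a0|a0] := eqVneq (v1 *m A *m v1^T) 0; first by exists v1.
have [v2 v2_0 v21] := exists_left_null (A *m v1^T) n2.
have [b0|b0] := eqVneq (v2 *m A *m v2^T) 0; first by exists v2.
have [v3 v3_0] := exists_left_null (row_mx (A *m v1^T) (A *m v2^T)) n3.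
rewrite mul_mx_row -(row_mx0 _ _ 1 1) => /eq_row_mx[v31 v32].
have [c0|c0] := eqVneq (v3 *m A *m v3^T) 0; first by exists v3.
have v12 := orthC _ _ v21; have v13 := orthC _ _ v31; have v23 := orthC _ _ v32.
rewrite mulmxA in v21; rewrite mulmxA in v31; rewrite mulmxA in v32.
have [x [y xy]] : exists x y, (v1 *m A *m v1^T) 0 0 * x ^+ 2 +
    (v2 *m A *m v2^T) 0 0 * y ^+ 2 = - (v3 *m A *m v3^T) 0 0.
  apply: binary_form_onto.
  - by apply: contraNneq a0 => e; apply/eqP; rewrite [LHS]mx11_scalar e raddf0.
  - by apply: contraNneq b0 => e; apply/eqP; rewrite [LHS]mx11_scalar e raddf0.
exists (x *: v1 + y *: v2 + v3).
  (* The vector is nonzero because it pairs with [v3] to the nonzero value [v3 *m A *m v3^T]. *)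
  apply: contraNneq c0 => w0.
  have := congr1 (fun w => w *m A *m v3^T) w0.
  by rewrite !mul0mx !mulmxDl -!scalemxAl v13 v23 !scaler0 !add0r => ->.
have -> : (x *: v1 + y *: v2 + v3)^T = x *: v1^T + y *: v2^T + v3^T.
  by rewrite !linearD !linearZ.
rewrite !mulmxDl !mulmxDr -!scalemxAl -!scalemxAr.
rewrite v12 v21 v13 v31 v23 v32 !scaler0 ?addr0 ?add0r.
move: (v1 *m A *m v1^T) (v2 *m A *m v2^T) (v3 *m A *m v3^T) xy => M1 M2 M3 xy.
apply/matrixP => i j; rewrite !ord1 !mxE -[M3 0 0]opprK -xy.
by ring.
Qed.

End Counting.

(** * Bias of quadratic forms *)

Section HyperbolicSplitting.
Variable F : finFieldType.
Local Notation q := (#|F|).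
Hypothesis q_odd : odd q.

Definition hyperbolic_plane : 'M[F]_(1 + 1) := block_mx 0 1%:M 1%:M 0.

Lemma hyperbolic_planeK : hyperbolic_plane *m hyperbolic_plane = 1%:M.
Proof.
rewrite mulmx_block !mulmx0 !mul0mx !mulmx1 !addr0 !add0r.
by rewrite -scalar_mx_block.
Qed.

Lemma null_space_basis n k r (D : 'M[F]_(n, k)) : (n - \rank D)%N = r ->
  exists C : 'M[F]_(r, n), row_free C /\ C *m D = 0.
Proof.
rewrite -mxrank_ker => <-; exists (row_base (kermx D)).
by split; [exact: row_base_free | apply/sub_kermxP; rewrite eq_row_base].
Qed.

(** Nondegeneracy gives an isotropic vector [v] a partner pairing to 1 with it, and a multiple of
    [v] corrects the partner to an isotropic one. *)
Lemma hyperbolic_pair n (A : 'M[F]_n) : (3 <= n)%N -> A^T = A -> A \in unitmx ->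
  exists D : 'M[F]_(1 + 1, n), D *m A *m D^T = hyperbolic_plane.
Proof.
move=> n3 symA uA; have [v v0 vv] := exists_isotropic q_odd n3 symA.
have /row_freeP[B vB] : row_free (v *m A).
  have vA0 : v *m A != 0 by apply: contraNneq v0 => e; rewrite -(mulmxK uA v) e mul0mx.
  by rewrite /row_free rank_rV vA0.
have Bv : B^T *m A *m v^T = 1%:M.
  by apply: trmx_inj; rewrite !trmx_mul !trmxK symA mulmxA vB trmx1.
(* Subtracting [c *: v] from [B^T] lowers the value of the form there by [2 * c], hence this
   choice. *)
pose c := (B^T *m A *m B) 0 0 / 2%:R.
exists (col_mx v (B^T - c *: v)).
rewrite tr_col_mx mul_col_mx mul_col_mx !mul_mx_row -block_mxEv.
have -> : (B^T - c *: v)^T = B - c *: v^T by rewrite linearB linearZ /= trmxK.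
rewrite !mulmxBr !mulmxBl -!scalemxAr -!scalemxAl vB Bv vv ?scaler0 !subr0.
congr block_mx; rewrite [B^T *m A *m B]mx11_scalar -/c.
rewrite !scalemx1 -!raddfB /= -addrA -opprD -mulr2n -mulr_natr.
by rewrite divfK ?two_neq0 // subrr raddf0.
Qed.

(** The Gram matrix of the hyperbolic pair [D] is invertible, so its span and its orthogonal
    complement, with basis [C], are in direct sum. *)
Lemma hyperbolic_split n (A : 'M[F]_(1 + 1 + n)) : (0 < n)%N ->
  A^T = A -> A \in unitmx ->
  exists P : 'M[F]_(1 + 1 + n), exists A' : 'M[F]_n,
  [/\ P \in unitmx, A'^T = A', A' \in unitmx &
      P *m A *m P^T = block_mx hyperbolic_plane 0 0 A'].
Proof.
move=> n0 symA uA; have [|D DA] := @hyperbolic_pair _ A _ symA uA; first by lia.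
have freeD : row_free D.
  apply/row_freeP; exists (A *m D^T *m hyperbolic_plane).
  by rewrite !mulmxA DA hyperbolic_planeK.
have rkAD : \rank (A *m D^T) = 2%N.
  rewrite -mxrank_tr trmx_mul trmxK symA mxrankMfree ?row_free_unit //.
  exact/eqP.
have [|C [freeC CD]] := @null_space_basis _ _ n (A *m D^T); first by rewrite rkAD addKn.
have DC : D *m A *m C^T = 0.
  by apply: trmx_inj; rewrite !trmx_mul !trmxK symA CD trmx0.
have PA : col_mx D C *m A *m (col_mx D C)^T =
    block_mx hyperbolic_plane 0 0 (C *m A *m C^T).
  rewrite tr_col_mx mul_col_mx mul_col_mx !mul_mx_row -block_mxEv.
  by rewrite DA DC -mulmxA CD.
have uP : col_mx D C \in unitmx.
  rewrite -row_free_unit; apply: inj_row_free => u.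
  rewrite -[u]hsubmxK mul_row_col => uP.
  (* Pairing with [D] kills the [C] part and leaves the [D] part times an invertible matrix. *)
  have y0 : lsubmx u = 0.
    move/(congr1 (mulmx^~ (A *m D^T))): (uP).
    rewrite mulmxDl -!(mulmxA _ _ (A *m D^T)) CD (mulmxA D) DA mulmx0 addr0 mul0mx => y0.
    by rewrite -[LHS]mulmx1 -hyperbolic_planeK mulmxA y0 mul0mx.
  have z0 : rsubmx u = 0.
    by apply: (row_free_inj freeC); rewrite mul0mx -uP y0 mul0mx add0r.
  by rewrite y0 z0 row_mx0.
exists (col_mx D C), (C *m A *m C^T); split=> //.
  by rewrite !trmx_mul trmxK symA mulmxA.
have : block_mx hyperbolic_plane 0 0 (C *m A *m C^T) \in unitmx.
  by rewrite -PA !unitmx_mul uP uA unitmx_tr.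
by rewrite !unitmxE det_ublock unitrM => /andP[].
Qed.

End HyperbolicSplitting.

(** * Effect of a hyperbolic plane on the bias *)

Section HyperbolicBias.
Variable F : finFieldType.
Local Notation q := (#|F|).
Hypothesis q_odd : odd q.
#[local] Hint Resolve qr_neq0 qr1_neq0 : core.

Lemma form_zeros_congr m n (H : 'M[F]_m) (A P : 'M[F]_n) : P \in unitmx ->
  form_zeros H (P *m A *m P^T) = form_zeros H A.
Proof.
move=> uP; rewrite /form_zeros -(card_imset _ (can_inj (mulmxK uP))).
apply: eq_card => X; rewrite inE; apply/imsetP/idP => [[Y + ->]|X0].
  by rewrite inE trmx_mul !mulmxA.
exists (X *m invmx P); rewrite ?mulmxKV // inE.
by rewrite !trmx_mul !mulmxA mulmxKV // -(mulmxA _ P^T) -trmx_mul mulVmx // trmx1 mulmx1.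
Qed.

Lemma card_set_sum (T : finType) (P : pred T) : #|[set x | P x]| = (\sum_x P x)%N.
Proof. by rewrite -sum1dep_card big_mkcond; apply: eq_bigr => x _; case: (P x). Qed.

Lemma form_zerosE m n (H : 'M[F]_m) (A : 'M[F]_n) :
  form_zeros H A = (\sum_(X : 'M[F]_(m, n)) (\tr (X *m A *m X^T *m H) == 0)%R)%N.
Proof. exact: card_set_sum. Qed.

(** With [X] split into columns [y1], [y2] and a block [Z], the form is [2 y1^T H y2] plus a term in
    [Z], hence affine in [y2]. The two summands collect the [y1] inside and outside the kernel of
    [H]. *)
Lemma form_zeros_hyperbolic m n (H : 'M[F]_m) (A : 'M[F]_n) : H^T = H ->
  (q * form_zeros H (block_mx (hyperbolic_plane F) 0 0 A) =
   q ^ (m - \rank H) * form_zeros H A * q ^ m.+1 +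
   (q ^ m - q ^ (m - \rank H)) * q ^ (m * n) * q ^ m)%N.
Proof.
move=> symH; rewrite form_zerosE.
(* This order of the triple reads [((y1, Z), y2)] only after the swap made by [g]; see the next step
   for the innermost sum over [y2]. *)
pose g (t : ('cV[F]_m * 'M[F]_(m, n)) * 'cV[F]_m) := row_mx (row_mx t.1.1 t.2) t.1.2.
rewrite (reindex g) /=; last first.
  exists (fun X => ((lsubmx (lsubmx X), rsubmx X), rsubmx (lsubmx X))).
    by case=> [[y1 Z] y2] _; rewrite /g /= !row_mxKl !row_mxKr.
  by move=> X _; rewrite /g /= !hsubmxK.
rewrite -(pair_bigA _ (fun t y2 => (\tr (g (t, y2) *m block_mx (hyperbolic_plane F) 0 0 A
  *m (g (t, y2))^T *m H) == 0)%R : nat)) /=.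
rewrite big_distrr /=.
have trE y1 Z y2 : \tr (g ((y1, Z), y2) *m block_mx (hyperbolic_plane F) 0 0 A
    *m (g ((y1, Z), y2))^T *m H) =
    \tr ((2%:R *: (y1^T *m H)) *m y2) + \tr (Z *m A *m Z^T *m H).
  rewrite /g /= tr_row_mx mul_row_block !mulmx0 addr0 add0r mul_row_col tr_row_mx.
  rewrite mul_row_block !mulmx0 !mulmx1 addr0 add0r mul_row_col mulmxDl mxtraceD.
  congr (_ + _); rewrite mulmxDl mxtraceD -scalemxAl mxtraceZ mulr_natl mulr2n.
  congr (_ + _); first by rewrite -mulmxA mxtrace_mulC.
  by rewrite -mxtrace_tr !trmx_mul trmxK symH mulmxA mxtrace_mulC mulmxA.
rewrite (eq_bigr (fun t : 'cV[F]_m * 'M[F]_(m, n) => if t.1^T *m H == 0 then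
    ((\tr (t.2 *m A *m t.2^T *m H) == 0)%R * q ^ m.+1)%N else (q ^ m)%N)); last first.
  case=> y1 Z _; under eq_bigr => y2 _ do rewrite trE.
  rewrite -card_set_sum card_affine_hyperplane scaler_eq0.
  by rewrite (negPf (two_neq0 q_odd)).
rewrite -(pair_bigA _ (fun (y1 : 'cV[F]_m) (Z : 'M[F]_(m, n)) =>
  if y1^T *m H == 0 then ((\tr (Z *m A *m Z^T *m H) == 0)%R * q ^ m.+1)%N
  else (q ^ m)%N)) /=.
rewrite (bigID (fun y1 : 'cV[F]_m => y1^T *m H == 0)) /=.
have kerE : #|[set y : 'cV[F]_m | y^T *m H == 0]| = (q ^ (m - \rank H))%N.
  rewrite -card_right_kernel; apply: eq_card => y; rewrite !inE.
  by rewrite -(inj_eq (@trmx_inj _ _ _)) trmx_mul trmxK symH trmx0.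
congr (_ + _)%N.
  under eq_bigr => y1 -> do rewrite -big_distrl -form_zerosE /=.
  by rewrite sum_nat_cond_const -kerE cardsE mulnA.
under eq_bigr => y1 /negPf-> do rewrite sum_nat_const.
rewrite sum_nat_cond_const mulnA card_mx; congr (_ * _ * _)%N.
have <- : #|'cV[F]_m| = (q ^ m)%N by rewrite card_mx muln1.
rewrite -kerE -(cardsC [set y : 'cV[F]_m | y^T *m H == 0]) addKn.
by apply: eq_card => y; rewrite !inE.
Qed.

(** In terms of characters, the sum over [y2] vanishes unless [y1] lies in the kernel of [H], a
    proportion [q^(- rank H)] of all [y1]. *)
Lemma form_bias_hyperbolic m n (H : 'M[F]_m) (A : 'M[F]_n) : H^T = H ->
  form_bias H (block_mx (hyperbolic_plane F) 0 0 A) =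
  q%:R ^- \rank H * form_bias H A.
Proof.
move=> symH; rewrite /form_bias -natrM form_zeros_hyperbolic //.
have rm : (m = (m - \rank H) + \rank H)%N by rewrite subnK ?rank_leq_row.
set r := \rank H in rm *; rewrite mulnDr.
have -> : (m * (1 + 1))%N = (m + m)%N by lia.
rewrite !natrD !natrM natrB ?leq_exp2l ?finNzRing_gt1 ?leq_subr // !natrX.
rewrite !exprD [in LHS]exprS.
have -> : q%:R ^+ m = q%:R ^+ (m - r) * q%:R ^+ r :> rat by rewrite -exprD -rm.
have q0 : q%:R != 0 :> rat by [].
have q1 : q%:R - 1 != 0 :> rat by [].
by field; rewrite ?expf_neq0 ?q0 ?q1.
Qed.

End HyperbolicBias.

(** * Bias for nondegenerate forms in an odd number of variables *)

Section OddBias.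
Variable F : finFieldType.
Local Notation q := (#|F|).
Hypothesis q_odd : odd q.
#[local] Hint Resolve qr_neq0 qr1_neq0 : core.

(** Scaling a form by a nonzero constant keeps its zeros, so the square class of the entry of [A]
    does not matter. *)
Lemma form_bias_unit1 m (H : 'M[F]_m) (A : 'M[F]_1) : A \in unitmx ->
  form_bias H A = form_bias H (1%:M : 'M_1).
Proof.
rewrite [A]mx11_scalar unitmxE det_scalar1 unitfE => a0.
rewrite /form_bias; congr ((_ * _%:R - _) / _); apply: eq_card => X; rewrite !inE.
by rewrite mul_mx_scalar mulmx1 -!scalemxAl mxtraceZ mulf_eq0 (negPf a0).
Qed.

(** Hyperbolic planes are peeled off [k] times, each contributing [q^(- rank H)], until a form in
    one variable remains. *)
Lemma form_bias_odd k n (A : 'M[F]_n) m (H : 'M[F]_m) : n = k.*2.+1 ->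
  A^T = A -> A \in unitmx -> H^T = H ->
  form_bias H A = q%:R ^- (k * \rank H) * form_bias H (1%:M : 'M_1).
Proof.
move=> + + + symH; elim: k n A => [|k IHk] n A nE.
  by subst n => _ uA; rewrite form_bias_unit1 // expr0 invr1 mul1r.
rewrite doubleS in nE; subst n => symA uA.
have [//|P [A' [uP symA' uA' PA]]] := @hyperbolic_split _ q_odd _ A _ symA uA.
rewrite -[LHS](_ : form_bias H (P *m A *m P^T) = _); last first.
  by rewrite /form_bias form_zeros_congr.
rewrite PA form_bias_hyperbolic // IHk // mulrA -invfM -exprD.
by rewrite mulSn addnC.
Qed.

(** By symmetry a basis [B] of the row space also spans the column space; with [R] a right inverse
    of [B], the middle factor is [R^T *m H *m R]. *)
Lemma symmetric_factor m (H : 'M[F]_m) : H^T = H ->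
  exists B : 'M[F]_(\rank H, m), exists C : 'M[F]_(\rank H),
  [/\ row_free B, C^T = C, C \in unitmx & H = B^T *m C *m B].
Proof.
(* A free size [k] in place of [\rank H] lets [H] be rewritten without changing types. *)
move=> symH; suff gen k (B : 'M[F]_(k, m)) (cB : 'M[F]_(m, k)) :
    k = \rank H -> row_free B -> cB *m B = H -> exists B : 'M[F]_(k, m),
    exists C : 'M[F]_k, [/\ row_free B, C^T = C, C \in unitmx & H = B^T *m C *m B].
  exact: (gen _ (row_base H) (col_base H) _ (row_base_free H) (mulmx_base H)).
move=> rk freeB HcB.
have [R BR] := row_freeP freeB.
have cbE : B^T *m (cB^T *m R) = cB.
  by rewrite mulmxA -trmx_mul HcB symH -HcB -mulmxA BR mulmx1.
have HE : H = B^T *m (cB^T *m R) *m B by rewrite cbE HcB.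
have CE : cB^T *m R = R^T *m H *m R.
  by rewrite HE !mulmxA -trmx_mul BR trmx1 mul1mx -!mulmxA BR mulmx1.
exists B, (cB^T *m R); split=> //; first by rewrite CE !trmx_mul trmxK symH mulmxA.
rewrite -row_free_unit /row_free eqn_leq rank_leq_row /= {1}rk {1}HE.
by rewrite (leq_trans (mxrankM_maxl _ _)) ?mxrankM_maxr.
Qed.

Lemma card_preimage_mulmx k m (B : 'M[F]_(k, m)) (P : pred 'cV[F]_k) : row_free B ->
  #|[set x : 'cV[F]_m | P (B *m x)]| = (q ^ (m - k) * #|[set y | P y]|)%N.
Proof.
move=> freeB; have [R BR] := row_freeP freeB.
rewrite !card_set_sum (partition_big (mulmx B) predT) //= big_distrr /=.
apply: eq_bigr => y _.
transitivity (\sum_(x | B *m x == y) P y)%N; first by apply: eq_bigr => x /eqP->.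
rewrite sum_nat_cond_const; congr (_ * _)%N.
have <- : #|[set u : 'cV[F]_m | B *m u == 0]| = (q ^ (m - k))%N.
  by rewrite card_right_kernel (eqP freeB).
rewrite -[RHS](card_imset _ (addrI (R *m y))); apply: eq_card => x; rewrite inE.
apply/eqP/imsetP => [<-|[u + ->]].
  exists (x - R *m (B *m x)); last by rewrite subrKC.
  by rewrite inE mulmxBr !mulmxA BR mul1mx subrr.
by rewrite inE mulmxDr mulmxA BR mul1mx => /eqP->; rewrite addr0.
Qed.

(** The form depends on [x] only through [B *m x], which is equidistributed. The roles of the two
    arguments of [form_bias] are exchanged, so that [form_bias_odd] applies to [C]. *)
Lemma form_bias_row_base m (H : 'M[F]_m) k (B : 'M[F]_(k, m)) (C : 'M[F]_k) :
  row_free B -> form_bias (B^T *m C *m B) (1%:M : 'M_1) = form_bias (1%:M : 'M_1) C.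
Proof.
move=> freeB; have km : (k <= m)%N by rewrite -(eqP freeB) rank_leq_col.
rewrite /form_bias muln1 mul1n.
have -> : form_zeros (B^T *m C *m B) (1%:M : 'M_1) =
    (q ^ (m - k) * form_zeros (1%:M : 'M_1) C)%N.
  transitivity #|[set x : 'cV[F]_m | \tr ((B *m x)^T *m C *m (B *m x)) == 0]|.
    apply: eq_card => x; rewrite !inE mulmx1 -mulmxA mxtrace_mulC.
    by rewrite trmx_mul !mulmxA.
  rewrite (card_preimage_mulmx (fun y => \tr (y^T *m C *m y) == 0)) //.
  congr (_ * _)%N; rewrite /form_zeros -(card_imset _ (@trmx_inj _ 1 k)).
  apply: eq_card => y; rewrite inE; apply/idP/imsetP => [y0|[Y + ->]].
    by exists y^T; rewrite ?trmxK // inE mulmx1 trmxK.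
  by rewrite inE trmxK mulmx1.
rewrite natrM natrX -{2 3}(subnK km) !exprD.
have q0 : q%:R != 0 :> rat by [].
have q1 : q%:R - 1 != 0 :> rat by [].
by field; rewrite ?expf_neq0 ?q0 ?q1.
Qed.

(** Reduction to a nondegenerate form in [\rank H] variables, then to one variable, where [x^2] has
    a single zero and hence bias 0. *)
Lemma form_bias_rank_odd m (H : 'M[F]_m) : H^T = H -> odd (\rank H) ->
  form_bias H (1%:M : 'M_1) = 0.
Proof.
move=> symH rH; have [B [C [freeB symC uC ->]]] := symmetric_factor symH.
rewrite form_bias_row_base // (form_bias_odd (k := (\rank H)./2)) ?trmx1 //; last first.
  by rewrite -[LHS]odd_double_half rH.
suff z1 : form_zeros (1%:M : 'M[F]_1) (1%:M : 'M_1) = 1%N.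
  by rewrite /form_bias z1 mulr1 subrr mul0r mulr0.
transitivity #|[set (0 : 'M[F]_1)]|; last exact: cards1.
apply: eq_card => X; rewrite !inE !mulmx1 trace_mx11 !mxE big_ord1 !mxE mulf_eq0 orbb.
apply/eqP/eqP => [X0|->]; last by rewrite mxE.
by rewrite [X]mx11_scalar X0 raddf0.
Qed.

End OddBias.

(** * Ranks of Hankel matrices *)

(** Concavity makes the increments nonincreasing, symmetry makes them nonnegative up to [m], and the
    first is at most 1: they are a run of ones followed by zeros. *)
Lemma concave_symmetric_minn (r : nat -> nat) m : (r 0 = 0)%N -> (r 1 <= 1)%N ->
  (forall a, a.+2 <= m + m -> r a + r a.+2 <= (r a.+1).*2)%N ->
  (forall a, a <= m + m -> r (m + m - a) = r a)%N ->
  forall a, (a <= m)%N -> r a = minn a (r m).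
Proof.
move=> r0 r1 concave sym.
have diff a d : (a + d < m + m -> r (a + d).+1 + r a <= r a.+1 + r (a + d))%N.
  elim: d => [|d IHd]; rewrite ?addn0 ?addnS => lt; first lia.
  have := concave (a + d)%N; have := IHd; lia.
(* The mirror image of this step about [m] comes later and has the opposite increment. *)
have mono1 a : (a < m -> r a <= r a.+1)%N.
  move=> lt; have := diff a (m + m - a - a).-1; have := sym a; have := sym a.+1.
  have -> : (a + (m + m - a - a).-1 = m + m - a.+1)%N by lia.
  have -> : ((m + m - a.+1).+1 = m + m - a)%N by lia.
  lia.
have mono a d : (a + d <= m -> r a <= r (a + d))%N.
  elim: d => [|d IHd]; rewrite ?addn0 ?addnS => lt //.
  have := mono1 (a + d)%N; have := IHd; lia.
have step a : (a < m -> r a.+1 <= (r a).+1)%N.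
  by move=> lt; have := diff 0%N a; rewrite add0n; lia.
have le_id a : (a <= m -> r a <= a)%N.
  elim: a => [|a IHa] lt; first lia.
  have := step a lt; have := IHa (ltnW lt); lia.
have flat a d : (0 < a -> a + d <= m -> r a = r a.-1 -> r (a + d) = r (a + d).-1)%N.
  move=> a0; elim: d => [|d IHd]; rewrite ?addn0 ?addnS //= => lt ra.
  have := concave (a + d).-1; have := mono1 (a + d)%N; have := IHd.
  have -> : ((a + d).-1.+1 = a + d)%N by lia.
  lia.
have flatE a d : (0 < a -> a + d <= m -> r a = r a.-1 -> r (a + d) = r a)%N.
  move=> a0; elim: d => [|d IHd]; rewrite ?addn0 ?addnS //= => lt ra.
  have := flat a d.+1; rewrite addnS /=; have := IHd; lia.
have dich a : (a <= m -> r a = a \/ (0 < a /\ r a = r a.-1))%N.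
  elim: a => [|a IHa] lt; first by left.
  have [||] := IHa; first lia; last first.
    by case=> a0 ra; right; have := flat a 1%N; rewrite addn1; lia.
  by move=> ra; have := step a; have := mono1 a; rewrite /=; lia.
move=> a lt; have := mono a (m - a)%N; rewrite subnKC // => /(_ (leqnn _)).
have [||[a0 ra]] := dich a => //; first lia.
have := flatE a (m - a)%N; rewrite subnKC // => /(_ a0 (leqnn _) ra).
have := le_id a.-1; lia.
Qed.

Section Hankel.
Variable F : fieldType.

Definition hankel (s : nat -> F) a b : 'M[F]_(a, b) := \matrix_(i, j) s (i + j)%N.

Lemma tr_hankel s a b : (hankel s a b)^T = hankel s b a.
Proof. by apply/matrixP => i j; rewrite !mxE addnC. Qed.

Lemma sub_kermx_hankel s a b (u : 'rV[F]_a) :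
  (u <= kermx (hankel s a b))%MS =
  [forall j : 'I_b, \sum_(i < a) u 0 i * s (i + j)%N == 0].
Proof.
rewrite sub_kermx; apply/eqP/forallP => [/rowP uH j|uH].
  by have := uH j; rewrite !mxE => /eqP; under eq_bigr do rewrite mxE.
by apply/rowP => j; rewrite !mxE; under eq_bigr do rewrite mxE; apply/eqP/uH.
Qed.

(* On left kernels, padding with a zero on the right or on the left
   (multiplication of polynomials by 1 and by X) maps into the kernel of the
   next matrix, and the two images meet in a copy of the previous kernel. *)
Lemma hankel_rank_concave s a b :
  (\rank (hankel s a b.+2) + \rank (hankel s a.+2 b) <=
   (\rank (hankel s a.+1 b.+1)).*2)%N.
Proof.
pose L (n : nat) : 'M[F]_(n, n.+1) := rowsub (widen_ord (leqnSn n)) 1%:M.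
pose R n : 'M[F]_(n, n.+1) := rowsub (lift ord0) 1%:M.
have Lw n (u : 'rV_n) i : (u *m L n) 0 (widen_ord (leqnSn n) i) = u 0 i.
  rewrite mxE (bigD1 i) //= !mxE eqxx mulr1 big1 ?addr0 // => j ji.
  by rewrite !mxE -val_eqE /= val_eqE (negPf ji) mulr0.
have Lm n (u : 'rV_n) : (u *m L n) 0 ord_max = 0.
  by rewrite mxE big1 // => j _; rewrite !mxE -val_eqE /= ltn_eqF ?mulr0.
have Rl n (u : 'rV_n) i : (u *m R n) 0 (lift ord0 i) = u 0 i.
  rewrite mxE (bigD1 i) //= !mxE eqxx mulr1 big1 ?addr0 // => j ji.
  by rewrite !mxE (inj_eq lift_inj) (negPf ji) mulr0.
have R0 n (u : 'rV_n) : (u *m R n) 0 ord0 = 0.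
  by rewrite mxE big1 // => j _; rewrite !mxE mulr0.
set K := kermx (hankel s a.+1 b.+1).
(* [L] appends a zero and [R] prepends one. *)
have sub : (K *m L a.+1 + K *m R a.+1 <= kermx (hankel s a.+2 b))%MS.
  rewrite addsmx_sub; apply/andP; split; apply/row_subP => k; rewrite row_mul.
    have : (row k K <= K)%MS by rewrite row_sub.
    rewrite !sub_kermx_hankel => /forallP kK; apply/forallP => j.
    rewrite big_ord_recr /= Lm mul0r addr0.
    have /eqP e := kK (widen_ord (leqnSn b) j).
    by apply/eqP; rewrite -[RHS]e; apply: eq_bigr => i _; rewrite Lw.
  have : (row k K <= K)%MS by rewrite row_sub.
  rewrite !sub_kermx_hankel => /forallP kK; apply/forallP => j.
  rewrite big_ord_recl /= R0 mul0r add0r.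
  have /eqP e := kK (lift ord0 j).
  by apply/eqP; rewrite -[RHS]e; apply: eq_bigr => i _; rewrite Rl /= /bump /= !add1n addSnnS.
(* A vector in both images has a zero at each end; [w] is what lies between. *)
have cap : (K *m L a.+1 :&: K *m R a.+1 <= kermx (hankel s a b.+2) *m (R a *m L a.+1))%MS.
  apply/rV_subP => u; rewrite sub_capmx => /andP[/submxP[x ux] /submxP[y uy]].
  rewrite mulmxA in ux; rewrite mulmxA in uy.
  have := submxMl x K; have := submxMl y K.
  move: (x *m K) (y *m K) ux uy => {}x {}y ux uy yK xK.
  pose w : 'rV_a := \row_i u 0 (lift ord0 (widen_ord (leqnSn a) i)).
  have xE : x = w *m R a.
    apply/rowP => i; rewrite -Lw -ux; have [j ->|->] := unliftP ord0 i.
      by rewrite Rl mxE; congr (u _ _); apply/val_inj.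
    by rewrite R0 uy -(R0 _ y); congr (_ _ _); exact/val_inj.
  have yE i : w 0 i = y 0 (widen_ord (leqnSn a) i) by rewrite mxE uy Rl.
  have ymax : y 0 ord_max = 0.
    by rewrite -Rl -uy ux -(Lm _ x); congr (_ _ _); apply/val_inj.
  rewrite ux xE -mulmxA submxMr //; move: xK yK; rewrite !sub_kermx_hankel.
  move=> /forallP xK /forallP yK; apply/forallP => j.
  (* All columns but the last are conditions satisfied by [y]; the last is the shifted last
     condition on [x]. *)
  have [jb|jb] := ltnP j b.+1.
    have := yK (Ordinal jb); rewrite big_ord_recr /= ymax mul0r addr0 => /eqP e.
    by apply/eqP; rewrite -[RHS]e; apply: eq_bigr => i _; rewrite yE.
  have -> : nat_of_ord j = b.+1 by apply/eqP; rewrite eqn_leq jb -ltnS ltn_ord.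
  have := xK ord_max; rewrite big_ord_recl /= xE R0 mul0r add0r => /eqP e.
  by apply/eqP; rewrite -[RHS]e; apply: eq_bigr => i _; rewrite Rl /bump /= add1n addnS -addSn.
have freeL n : row_free (L n).
  by apply: inj_row_free => u uL; apply/rowP => i; rewrite -Lw uL !mxE.
have freeR n : row_free (R n).
  by apply: inj_row_free => u uR; apply/rowP => i; rewrite -Rl uR !mxE.
have := mxrank_sum_cap (K *m L a.+1) (K *m R a.+1).
rewrite (mxrankMfree K (freeL _)) (mxrankMfree K (freeR _)).
have := mxrankS sub; have := leq_trans (mxrankS cap) (mxrankM_maxl _ _).
rewrite !mxrank_ker.
(* The dimension formula for sum and intersection, passed from kernels to ranks; the rank bounds
   make the subtractions exact. *)
have arith r0 r1 r2 t u : (r0 <= a -> r1 <= a.+1 -> r2 <= a.+2 -> u <= a - r0 ->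
    t <= a.+2 - r2 -> t + u = a.+1 - r1 + (a.+1 - r1) -> r0 + r2 <= r1.*2)%N by lia.
move=> h1 h2 h3.
exact: arith (rank_leq_row _) (rank_leq_row _) (rank_leq_row _) h1 h2 h3.
Qed.

(* Transposition makes the rank symmetric about a = m, so by concavity it
   increases with slope 1 until it reaches its plateau. *)
Lemma hankel_rank s m a : (a <= m)%N ->
  \rank (hankel s a (m + m - a)) = minn a (\rank (hankel s m m)).
Proof.
move=> am; pose r a : nat := \rank (hankel s a (m + m - a)).
have <- : r m = \rank (hankel s m m) by rewrite /r addnK.
apply: (@concave_symmetric_minn r) => // [||k km|k km]; rewrite /r.
- by apply/eqP; rewrite -leqn0 rank_leq_row.
- exact: rank_leq_row.
- have -> : (m + m - k = (m + m - k.+2).+2)%N by lia.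
  have -> : (m + m - k.+1 = (m + m - k.+2).+1)%N by lia.
  exact: hankel_rank_concave.
- by rewrite subKn // -mxrank_tr tr_hankel.
Qed.

End Hankel.

(** * Averaging the bias over moment matrices *)

Section Annihilators.
Variable F : finFieldType.
Local Notation q := (#|F|).

(** After exchanging the sums, the [s] that kill [B] and [p x] have index [q] among those that kill
    [B], and the term of [x] cancels, unless [p x] lies in the row space of [B^T]. *)
Lemma sum_card_annihilator (T : finType) N b (p : T -> 'rV[F]_N) (B : 'M[F]_(N, b)) :
  \sum_(s : 'rV[F]_N | s *m B == 0)
    (q%:R * #|[set x | s *m (p x)^T == 0]|%:R - #|T|%:R) =
  (q%:R - 1) * q%:R ^+ (N - \rank B) * #|[set x | (p x <= B^T)%MS]|%:R :> rat.
Proof.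
transitivity (\sum_(x : T) (q%:R * (\sum_(s : 'rV[F]_N | (s *m B == 0)%R)
    (s *m (p x)^T == 0)%R)%N%:R - (q ^ (N - \rank B))%N%:R) : rat).
  rewrite !sumrB -!big_distrr /=; congr (_ * _ - _).
    under [RHS]eq_bigr do rewrite natr_sum.
    rewrite exchange_big; apply: eq_bigr => s _.
    by rewrite card_set_sum natr_sum.
  rewrite !sumr_const -card_left_kernel -!mulrnA mulnC; congr (_ *+ (_ * _)).
  by apply: eq_card => s; rewrite !inE.
rewrite card_set_sum natr_sum big_distrr /=; apply: eq_bigr => x _.
have -> : (\sum_(s : 'rV[F]_N | (s *m B == 0)%R) (s *m (p x)^T == 0)%R)%N =
    (q ^ (N - \rank (row_mx B (p x)^T)))%N.
  rewrite -card_left_kernel card_set_sum big_mkcond; apply: eq_bigr => s _.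
  rewrite mul_mx_row -[0 in RHS]row_mx0.
  case: eqP => [->|sB]; last by case: eqP => // /eq_row_mx[].
  congr (nat_of_bool _); apply/eqP/eqP => [->//|/eq_row_mx[]//].
have rkE : \rank (row_mx B (p x)^T) = (\rank B + ~~ (p x <= B^T)%MS)%N.
  rewrite -mxrank_tr tr_row_mx trmxK -addsmxE.
  have [pB|pB] := boolP (p x <= B^T)%MS.
    by rewrite (addsmx_idPl pB) mxrank_tr addn0.
  have px0 : p x != 0 by apply: contraNneq pB => ->; rewrite sub0mx.
  have := mxrank_sum_cap B^T (p x); rewrite mxrank_tr rank_rV px0 => <-.
  rewrite [X in (_ + X)%N](_ : _ = 0%N) ?addn0 //.
  apply/eqP; rewrite -leqn0 -ltnS ltn_neqAle.
  have := mxrankS (capmxSr B^T (p x)); rewrite rank_rV px0 => ->; rewrite andbT.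
  apply: contra pB => /eqP cap1; apply: (submx_trans _ (capmxSl B^T (p x))).
  by rewrite -(geq_leqif (mxrank_leqif_sup (capmxSr B^T (p x)))) cap1 rank_rV px0.
rewrite rkE natrX; case: (p x <= B^T)%MS rkE => /= rkE.
  by rewrite addn0 mulr1 natrX mulrBl mul1r.
rewrite mulr0 natrX -exprS -subSn ?subn1 ?addn1 ?subSS ?subrr //.
by have := rank_leq_row (row_mx B (p x)^T); rewrite rkE addn1.
Qed.

Definition functional N (s : 'rV[F]_N) (p : {poly F}) : F := \sum_(k < N) s 0 k * p`_k.

Lemma functionalE N (s : 'rV[F]_N) p : s *m (poly_rV p)^T = (functional s p)%:M.
Proof.
rewrite [LHS]mx11_scalar; congr (_%:M); rewrite mxE.
by apply: eq_bigr => k _; rewrite !mxE.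
Qed.

Lemma functional_sum N (s : 'rV[F]_N) (I : Type) (r : seq I) (P : pred I) (p : I -> {poly F}) :
  functional s (\sum_(i <- r | P i) p i) = \sum_(i <- r | P i) functional s (p i).
Proof.
rewrite /functional exchange_big /=; apply: eq_bigr => k _.
by rewrite coef_sum big_distrr.
Qed.

Lemma functionalZ N (s : 'rV[F]_N) c p : functional s (c *: p) = c * functional s p.
Proof.
rewrite /functional big_distrr /=; apply: eq_bigr => k _.
by rewrite coefZ mulrCA.
Qed.

Lemma functionalXn N (s : 'rV[F]_N) k : functional s 'X^k = (rVpoly s)`_k.
Proof.
rewrite coef_rVpoly /functional; case: insubP => [i _ <-|].
  rewrite (bigD1 i) //= coefXn eqxx mulr1 big1 ?addr0 // => j ji.
  by rewrite coefXn -[_ == _ :> nat]/(j == i) (negPf ji) mulr0.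
rewrite -leqNgt => Nk; apply: big1 => i _.
by rewrite coefXn ltn_eqF ?mulr0 // (leq_trans (ltn_ord i)).
Qed.

Lemma rVpoly_sum a (u : 'rV[F]_a) : rVpoly u = \sum_(l < a) u 0 l *: 'X^l.
Proof.
rewrite {1}[u]row_sum_delta linear_sum; apply: eq_bigr => l _.
by rewrite linearZ /= rVpoly_delta.
Qed.

Lemma mul_hankel N (s : 'rV[F]_N) a b (u : 'rV[F]_a) (j : 'I_b) :
  (u *m hankel (fun k => (rVpoly s)`_k) a b) 0 j = functional s (rVpoly u * 'X^j).
Proof.
rewrite [rVpoly u]rVpoly_sum big_distrl functional_sum mxE; apply: eq_bigr => l _ /=.
by rewrite -scalerAl functionalZ -exprD functionalXn !mxE.
Qed.

(** The Hankel matrix is the Gram matrix, in the monomial bases, of the pairing that applies the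
    functional [s] to a product. *)
Lemma hankel_bilinear N (s : 'rV[F]_N) a b (u : 'rV[F]_a) (v : 'rV[F]_b) :
  (u *m hankel (fun k => (rVpoly s)`_k) a b *m v^T) 0 0 = functional s (rVpoly u * rVpoly v).
Proof.
rewrite [rVpoly v]rVpoly_sum big_distrr functional_sum mxE; apply: eq_bigr => l _ /=.
by rewrite mul_hankel -scalerAr functionalZ mulrC mxE.
Qed.

End Annihilators.

(** * Moment matrices and the number of polynomial solutions *)

Section Moments.
Variable F : finFieldType.
Local Notation q := (#|F|).
#[local] Hint Resolve qr_neq0 qr1_neq0 : core.

(** Multiplication by [g] on polynomials of size at most [b], truncated to [N] coefficients. *)
Definition mulpoly_mx N b (g : {poly F}) : 'M[F]_(b, N) := \matrix_(i, k) (g * 'X^i)`_k.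

Lemma mul_rV_mulpoly N b g (v : 'rV[F]_b) :
  v *m mulpoly_mx N b g = poly_rV (rVpoly v * g).
Proof.
apply/rowP => k; rewrite !mxE rVpoly_sum big_distrl coef_sum.
by apply: eq_bigr => i _; rewrite mxE /= -scalerAl coefZ mulrC [g * _]mulrC mulrC.
Qed.

(** Exchanges the roles of [s] and [u]: [u] is in the left kernel of the Hankel matrix of [s]
    exactly when [s] annihilates the multiples of [u]. *)
Lemma mul_tr_mulpoly N (s : 'rV[F]_N) a b (u : 'rV[F]_a) :
  s *m (mulpoly_mx N b (rVpoly u))^T = u *m hankel (fun k => (rVpoly s)`_k) a b.
Proof.
by apply/rowP => i; rewrite mul_hankel mxE; apply: eq_bigr => k _; rewrite !mxE.
Qed.

Lemma size_rVpoly d (u : 'rV[F]_d) : (size (rVpoly u) <= d)%N.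
Proof. exact: size_poly. Qed.

Lemma size_mulpoly_le (x y : {poly F}) a b : (size x <= a)%N -> (size y <= b)%N ->
  (size (x * y)%R <= (a + b).-1)%N.
Proof. by move=> xa yb; have := size_polyMleq x y; lia. Qed.

Lemma row_free_mulpoly N a b (g : {poly F}) : g != 0 -> (size g <= a)%N ->
  N = (a + b).-1 -> row_free (mulpoly_mx N b g).
Proof.
move=> g0 ga NE; apply: inj_row_free => v.
rewrite mul_rV_mulpoly => /(congr1 rVpoly); rewrite raddf0 poly_rV_K; last first.
  by rewrite NE addnC size_mulpoly_le ?size_rVpoly.
by move=> /eqP; rewrite mulf_eq0 (negPf g0) orbF => /eqP v0; rewrite -[v]rVpolyK v0 raddf0.
Qed.

Lemma sub_mulpoly N a b (g p : {poly F}) : g != 0 -> (size g <= a)%N ->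
  N = (a + b).-1 -> (size p <= N)%N ->
  (poly_rV p <= mulpoly_mx N b g)%MS = (g %| p) && (size (p %/ g)%R <= b)%N.
Proof.
move=> g0 ga NE pN; apply/submxP/andP => [[v]|[gp pb]].
  rewrite mul_rV_mulpoly => /(congr1 rVpoly); rewrite !poly_rV_K //; last first.
    by rewrite NE addnC size_mulpoly_le ?size_rVpoly.
  by move=> ->; rewrite dvdp_mull // mulpK ?size_rVpoly.
by exists (poly_rV (p %/ g)); rewrite mul_rV_mulpoly poly_rV_K // divpK.
Qed.

Definition col_polys m n (X : 'M[F]_(m, n)) (j : 'I_n) : {poly F} := rVpoly (col j X)^T.

(** A product of two polynomials of size at most [m] has at most [(m + m).-1] coefficients, so [s]
    is a functional on such products. *)
Definition moment_mx m (s : 'rV[F]_(m + m).-1) : 'M[F]_m :=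
  hankel (fun k => (rVpoly s)`_k) m m.

Lemma tr_moment_mx m (s : 'rV[F]_(m + m).-1) : (moment_mx s)^T = moment_mx s.
Proof. exact: tr_hankel. Qed.

Lemma trace_moment m n (A : 'M[F]_n) (X : 'M[F]_(m, n)) (s : 'rV[F]_(m + m).-1) :
  \tr (X *m A *m X^T *m moment_mx s) = functional s (qform_eval A (col_polys X)).
Proof.
rewrite -!mulmxA mxtrace_mulC /mxtrace /qform_eval functional_sum.
apply: eq_bigr => i _; rewrite functional_sum -!mulmxA mxE; apply: eq_bigr => j _.
rewrite -mulrA mulrCA mul_polyC functionalZ; congr (_ * _).
rewrite mulrC -hankel_bilinear trmxK mulmxA.
transitivity ((row j (X^T *m moment_mx s) *m col i X) 0 0).
  by rewrite !mxE; apply: eq_bigr => k _; rewrite !mxE.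
by rewrite row_mul tr_col.
Qed.

Lemma qform_eval1 m (X : 'M[F]_(m, 1)) :
  qform_eval 1%:M (col_polys X) = rVpoly X^T ^+ 2.
Proof.
rewrite /qform_eval !big_ord1 mxE eqxx polyC1 mulr1 -expr2 /col_polys.
by congr (rVpoly _^T ^+ 2); apply/matrixP => i j; rewrite !mxE !ord1.
Qed.

Lemma size_qform_eval n (A : 'M[F]_n) m (x : 'I_n -> {poly F}) :
  (forall i, size (x i) <= m)%N -> (size (qform_eval A x) <= (m + m).-1)%N.
Proof.
move=> xm; apply: (leq_trans (size_sum _ _ _)); apply/bigmax_leqP => i _.
apply: (leq_trans (size_sum _ _ _)); apply/bigmax_leqP => j _.
apply: size_mulpoly_le => //; rewrite mulrC mul_polyC.
exact: leq_trans (size_scale_leq _ _) (xm i).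
Qed.

Lemma size_col_polys m n (X : 'M[F]_(m, n)) i : (size (col_polys X i) <= m)%N.
Proof. exact: size_rVpoly. Qed.

(** By [trace_moment], the bias is the summand of [sum_card_annihilator] for the coefficient vector
    of the quadratic form, up to normalisation. *)
Lemma sum_form_bias m n (A : 'M[F]_n) b (B : 'M[F]_((m + m).-1, b)) :
  \sum_(s : 'rV_(m + m).-1 | s *m B == 0) form_bias (moment_mx s) A =
  q%:R ^+ ((m + m).-1 - \rank B) / q%:R ^+ (m * n) *
  #|[set X : 'M[F]_(m, n) | (poly_rV (qform_eval A (col_polys X)) <= B^T)%MS]|%:R.
Proof.
have := sum_card_annihilator (fun X : 'M[F]_(m, n) => poly_rV (qform_eval A (col_polys X))) B.
set R := \sum_(_ | _) _ => RE.
transitivity (R / ((q%:R - 1) * q%:R ^+ (m * n))).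
  rewrite /R big_distrl; apply: eq_bigr => s _; rewrite /form_bias card_mx natrX.
  congr ((_ * _%:R - _) / _); apply: eq_card => X; rewrite !inE trace_moment.
  rewrite functionalE; apply/eqP/eqP => [->|]; first by rewrite raddf0.
  by move/matrixP/(_ 0 0); rewrite !mxE.
rewrite RE.
have q0 : q%:R != 0 :> rat by [].
have q1 : q%:R - 1 != 0 :> rat by [].
by field; rewrite ?expf_neq0 ?q0 ?q1.
Qed.

Definition num_solutions m n (A : 'M[F]_n) : nat :=
  #|[set X : 'M[F]_(m, n) | qform_eval A (col_polys X) == 0]|.

(** The case [B = 0] of [sum_form_bias]: every [s] occurs, and only the [X] whose coefficient vector
    is zero are counted. *)
Lemma num_solutionsE m n (A : 'M[F]_n) :
  (num_solutions m A)%:R = q%:R ^+ (m * n) / q%:R ^+ (m + m).-1 *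
     \sum_(s : 'rV_(m + m).-1) form_bias (moment_mx s) A.
Proof.
have := sum_form_bias A (0 : 'M_((m + m).-1)).
rewrite (eq_bigl predT) => [->|s]; last by rewrite mulmx0 eqxx.
rewrite mxrank0 subn0 trmx0.
have -> : #|[set X : 'M[F]_(m, n) | (poly_rV (qform_eval A (col_polys X)) <=
   (0 : 'M[F]_((m + m).-1)))%MS]| = num_solutions m A.
  apply: eq_card => X; rewrite !inE.
 rewrite submx0; apply/eqP/eqP => [|->]; last by rewrite raddf0.
  move/(congr1 rVpoly); rewrite raddf0 poly_rV_K // size_qform_eval // => i.
  exact: size_col_polys.
have q0 : q%:R != 0 :> rat by [].
by field; rewrite ?expf_neq0 ?q0.
Qed.

End Moments.

(** * Total bias of the moment matrices of a given rank *)

Section RankBias.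
Variable F : finFieldType.
Local Notation q := (#|F|).
#[local] Hint Resolve qr_neq0 qr1_neq0 : core.

(** Counts the [x] whose square is [g] times a polynomial of size at most [2m - a], the condition
    that [sum_form_bias] produces for the form [x^2]. *)
Definition square_multiples m a (g : {poly F}) : nat :=
  #|[set x : 'rV[F]_m | (g %| rVpoly x ^+ 2) &&
       (size (rVpoly x ^+ 2 %/ g)%R <= m + m - a)%N]|.

Lemma uphalf_bounds n : (n <= (uphalf n).*2 <= n.+1)%N.
Proof.
have := uphalf_half n; have := odd_double_half n.
move: (uphalf n) (n./2) => u h; case: (odd n) => /= <- ->; apply/andP; split; lia.
Qed.

(** For nonzero [p] the quotient has size [2 * size p - size g]; halving the inequality rounds
    [a - size g] up. *)
Lemma size_square_quotient m a (g p : {poly F}) : g != 0 -> (size g <= a)%N -> (a <= m)%N ->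
  g %| p ^+ 2 ->
  (size (p ^+ 2 %/ g)%R <= m + m - a)%N = (size p <= m - uphalf (a - size g))%N.
Proof.
move=> g0 ga am gp; have [->|p0] := eqVneq p 0.
  by rewrite expr0n div0p size_poly0.
rewrite size_divp // expr2 size_mul //.
have := uphalf_bounds (a - size g).
have : (0 < size g)%N by rewrite size_poly_gt0.
have : (0 < size p)%N by rewrite size_poly_gt0.
move: (size p) (size g) ga => k l la k0 l0 /andP[].
move: (uphalf _) => u; lia.
Qed.

(* Subtracting a multiple of 'X^d * g kills the top coefficient of x without
   affecting whether g divides its square. *)
Lemma square_multiplesS m a (g : {poly F}) : g != 0 -> (size g <= a)%N -> (a <= m)%N ->
  square_multiples m.+1 a g = (q * square_multiples m a g)%N.
Proof.
move=> g0 ga am; rewrite /square_multiples.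
pose M := (m - uphalf (a - size g))%N.
have sg : (0 < size g)%N by rewrite size_poly_gt0.
have [Mg Mm MS] : [/\ size g <= M.+1, M <= m & m.+1 - uphalf (a - size g) = M.+1]%N.
  rewrite /M; have := uphalf_bounds (a - size g).
  by move: (size g) (uphalf _) ga sg => l u la l0 /andP[] *; split; lia.
have SM k p : (a <= k)%N -> (g %| p ^+ 2) && (size (p ^+ 2 %/ g)%R <= k + k - a)%N =
    (g %| p ^+ 2) && (size p <= k - uphalf (a - size g))%N.
  by move=> ak; case: (boolP (g %| _)) => //= gp; rewrite size_square_quotient.
pose S := [set x : 'rV[F]_m | (g %| rVpoly x ^+ 2) &&
       (size (rVpoly x ^+ 2 %/ g)%R <= m + m - a)%N].
(* A multiple of [g] whose top coefficient sits at the one position allowed for [m.+1] but not for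
   [m]. *)
pose h : {poly F} := 'X^(M.+1 - size g) * g.
have gh : g %| h by rewrite dvdp_mull.
have sh : size h = M.+1.
  by rewrite /h mulrC size_mulXn // subnK.
have hM : h`_M != 0 by rewrite -[M]/(M.+1.-1) -sh -lead_coefE lead_coef_eq0 -size_poly_eq0 sh.
pose f (t : F * 'rV[F]_m) : 'rV[F]_m.+1 := poly_rV (rVpoly t.2 + t.1 *: h).
have fK (t : F * 'rV[F]_m) : rVpoly (f t) = rVpoly t.2 + t.1 *: h.
  rewrite poly_rV_K // (leq_trans (size_polyD _ _)) // geq_max.
  rewrite (leq_trans (size_rVpoly _)) // (leq_trans (size_scale_leq _ _)) //.
  by rewrite sh.
have sqE c (p : {poly F}) : (g %| (p + c *: h) ^+ 2) = (g %| p ^+ 2).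
  have -> : (p + c *: h) ^+ 2 = p ^+ 2 + h * (p * c%:P *+ 2 + c%:P ^+ 2 * h).
    by rewrite -mul_polyC; ring.
  by rewrite dvdp_addl // dvdp_mulr.
rewrite -/S -(cardsT F) -cardsX -(card_in_imset (f := f)); last first.
  case=> [c x] [d y]; rewrite !inE !SM // => /= /andP[_ sx] /andP[_ sy] /(congr1 rVpoly).
  rewrite !fK /= => e; have cd : c = d.
    have := congr1 (fun p : {poly F} => p`_M) e.
    rewrite !coefD !coefZ [(rVpoly x)`_M]nth_default // [(rVpoly y)`_M]nth_default //.
    by rewrite !add0r => /(mulIf hM).
  by move: e; rewrite cd => /addIr/(can_inj (@rVpolyK _ _))->.
apply: eq_card => y; apply/idP/imsetP => [|[[c x] + ->]]; last first.
  rewrite !inE !SM // ?(leq_trans am) //= => /andP[gx sx]; rewrite fK /= sqE gx /=.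
  rewrite MS (leq_trans (size_polyD _ _)) // geq_max (leq_trans sx) ?leqnSn //=.
  by rewrite (leq_trans (size_scale_leq _ _)) // sh.
rewrite inE SM ?(leq_trans am) // => /andP[gy sy].
pose c : F := (rVpoly y)`_M / h`_M.
have sx : (size (rVpoly y - c *: h)%R <= M)%N.
  apply/leq_sizeP => j; rewrite leq_eqVlt => /orP[/eqP<-|Mj].
    by rewrite coefB coefZ divfK // subrr.
  rewrite coefB coefZ [h`_j]nth_default ?sh // mulr0 subr0 nth_default //.
  by apply: leq_trans sy _; rewrite MS.
have xK : rVpoly (poly_rV (rVpoly y - c *: h) : 'rV_m) = rVpoly y - c *: h.
  by rewrite poly_rV_K // (leq_trans sx).
exists (c, poly_rV (rVpoly y - c *: h)).
  by rewrite !inE SM // xK -scaleNr sqE gy /= scaleNr.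
by apply: (can_inj (@rVpolyK _ _)); rewrite fK /= xK subrK.
Qed.

Definition moment_bias m (s : 'rV[F]_(m + m).-1) : rat :=
  form_bias (moment_mx s) (1%:M : 'M_1).

Definition rank_bias m r : rat :=
  \sum_(s : 'rV[F]_(m + m).-1 | \rank (moment_mx s) == r) moment_bias s.

Lemma sum_by_rank m (w : nat -> rat) :
  \sum_(s : 'rV[F]_(m + m).-1) w (\rank (moment_mx s)) * moment_bias s =
  \sum_(r < m.+1) w r * rank_bias m r.
Proof.
have rk (s : 'rV[F]_(m + m).-1) : (\rank (moment_mx s) < m.+1)%N.
  by rewrite ltnS rank_leq_row.
rewrite (partition_big (fun s => Ordinal (rk s)) predT) //=.
apply: eq_bigr => r _; rewrite /rank_bias big_distrr /=.
by apply: eq_big => [s|s /eqP<-] //; rewrite -val_eqE.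
Qed.

(* Both sides sum the bias over the pairs (s, u) with u nonzero in the left
   kernel of the a x (2m - a) Hankel matrix of s. *)
Lemma sum_kernel_bias m a : (0 < a)%N -> (a <= m)%N ->
  \sum_(s : 'rV[F]_(m + m).-1)
     (q%:R ^+ (a - minn a (\rank (moment_mx s))) - 1) * moment_bias s =
  \sum_(u : 'rV[F]_a | u != 0)
     q%:R ^+ a.-1 / q%:R ^+ m * (square_multiples m a (rVpoly u))%:R.
Proof.
move=> a0 am; pose b := (m + m - a)%N; pose N := (m + m).-1.
have NE : N = (a + b).-1 by rewrite /N /b; lia.
transitivity (\sum_(s : 'rV[F]_N) \sum_(u : 'rV[F]_a | u != 0)
   if s *m (mulpoly_mx N b (rVpoly u))^T == 0 then moment_bias s else 0).
  (* The weight is the size of the left kernel minus one, that is, the number of nonzero [u] in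
     it. *)
  apply: eq_bigr => s _; rewrite -hankel_rank // -natrX -card_left_kernel.
  rewrite card_set_sum (bigD1 0) //= mul0mx eqxx natrD addrC addKr natr_sum big_distrl /=.
  by apply: eq_bigr => u _; rewrite mul_tr_mulpoly; case: eqP; rewrite ?mul1r ?mul0r.
rewrite exchange_big /=; apply: eq_bigr => u u0; rewrite -big_mkcond /=.
have p0 : rVpoly u != 0.
  by apply: contraNneq u0 => e; rewrite -[u]rVpolyK e raddf0.
rewrite sum_form_bias muln1 mxrank_tr.
have /eqP-> := row_free_mulpoly p0 (size_rVpoly u) NE.
have -> : ((m + m).-1 - b = a.-1)%N by rewrite /b; lia.
congr (_ * _%:R); rewrite trmxK /square_multiples -(card_imset _ (@trmx_inj _ m 1)).
have sub (X : 'M[F]_(m, 1)) : (poly_rV (qform_eval 1%:M (col_polys X)) <=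
    mulpoly_mx N b (rVpoly u))%MS = (rVpoly u %| rVpoly X^T ^+ 2) &&
    (size (rVpoly X^T ^+ 2 %/ rVpoly u)%R <= b)%N.
  rewrite (sub_mulpoly p0 (size_rVpoly u) NE) qform_eval1 // expr2.
  by apply: size_mulpoly_le; apply: size_rVpoly.
apply: eq_card => x; rewrite inE; apply/imsetP/idP => [[X + ->]|xS].
  by rewrite inE sub.
by exists x^T; rewrite ?trmxK // inE sub trmxK.
Qed.

(* The weights q^(a - min(a, r)) - 1 of [sum_kernel_bias] vanish for r >= a, so
   the identities for a = 1, ..., m form a triangular system for the values
   [rank_bias m 0, ..., rank_bias m m.-1]. *)
Lemma rank_bias_stable m r : (r < m)%N -> rank_bias m.+1 r = rank_bias m r.
Proof.
elim/ltn_ind: r => r IHr rm.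
have trunc k : (r < k)%N -> \sum_(s : 'rV[F]_(k + k).-1)
     (q%:R ^+ (r.+1 - minn r.+1 (\rank (moment_mx s))) - 1) * moment_bias s =
   (\sum_(i < r) (q%:R ^+ (r.+1 - i) - 1) * rank_bias k i) + (q%:R - 1) * rank_bias k r.
  move=> rk; rewrite (sum_by_rank _ (fun i => q%:R ^+ (r.+1 - minn r.+1 i) - 1)).
  rewrite -(big_mkord predT (fun i => (q%:R ^+ (r.+1 - minn r.+1 i) - 1) * rank_bias k i)).
  rewrite (big_cat_nat (n := r.+1)) ?leqW //= [X in _ + X]big1_seq ?addr0; last first.
    move=> i /andP[_]; rewrite mem_index_iota => /andP[ri _].
    by rewrite (minn_idPl _) // subnn expr0 subrr mul0r.
  rewrite big_mkord big_ord_recr /= (minn_idPr _) // subSnn expr1; congr (_ + _).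
  by apply: eq_bigr => i _; rewrite (minn_idPr _) // ltnW // ltnW // ltnS.
have := sum_kernel_bias (ltn0Sn r) rm.
(* The factor [q] from [square_multiplesS] cancels the extra [q] in the denominator, so this side is
   the same for [m] and [m.+1]. *)
have -> : \sum_(u : 'rV[F]_r.+1 | u != 0)
     q%:R ^+ r / q%:R ^+ m * (square_multiples m r.+1 (rVpoly u))%:R =
   \sum_(u : 'rV[F]_r.+1 | u != 0)
     q%:R ^+ r / q%:R ^+ m.+1 * (square_multiples m.+1 r.+1 (rVpoly u))%:R :> rat.
  apply: eq_bigr => u u0; rewrite square_multiplesS ?size_rVpoly //; last first.
    by apply: contraNneq u0 => e; rewrite -[u]rVpolyK e raddf0.
  have q0 : q%:R != 0 :> rat by [].
  by rewrite natrM exprS; field; rewrite ?expf_neq0 ?q0.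
rewrite -(sum_kernel_bias (ltn0Sn r) (leqW rm)) (trunc m) // (trunc m.+1) ?leqW //.
rewrite (eq_bigr (fun i : 'I_r => (q%:R ^+ (r.+1 - i) - 1) * rank_bias m.+1 i)).
  by move/addrI/(mulfI (qr1_neq0 F)).
by move=> i _; rewrite IHr // (ltn_trans _ rm).
Qed.

End RankBias.

(** * Weighted sums of the rank biases *)

Section WeightedBias.
Variable F : finFieldType.
Local Notation q := (#|F|).
#[local] Hint Resolve qr_neq0 qr1_neq0 : core.

(** The equation [x^2 = 0] has one solution, and [num_solutionsE] for this form is solved for the
    total bias. *)
Lemma sum_rank_bias m : (0 < m)%N ->
  \sum_(r < m.+1) rank_bias F m r = q%:R ^+ m.-1.
Proof.
move=> m0; have := num_solutionsE m (1%:M : 'M[F]_1).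
have -> : num_solutions m (1%:M : 'M[F]_1) = 1%N.
  transitivity #|[set (0 : 'M[F]_(m, 1))]|; last exact: cards1.
  apply: eq_card => X; rewrite !inE qform_eval1 expf_eq0 /=.
  apply/eqP/eqP => [X0|->]; last by rewrite trmx0 raddf0.
  by rewrite -[X]trmxK -[X^T]rVpolyK X0 raddf0 trmx0.
have := sum_by_rank F m (fun=> 1); under eq_bigr do rewrite mul1r.
under [in RHS]eq_bigr do rewrite mul1r.
move=> <-; rewrite muln1.
have q0 : q%:R != 0 :> rat by [].
rewrite [X in _ / X](_ : _ = q%:R ^+ m * q%:R ^+ m.-1); last first.
  by rewrite -exprD; congr (_ ^+ _); lia.
rewrite invfM mulVKf ?expf_neq0 // => e.
rewrite -[LHS](mulKf (x := (q%:R ^+ m.-1)^-1)) ?invr_neq0 ?expf_neq0 //.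
by rewrite -[X in _ * X]e mulr1 invrK.
Qed.

Hypothesis q_odd : odd q.

Lemma rank_bias_odd m r : odd r -> rank_bias F m r = 0.
Proof.
move=> r1; apply: big1 => s /eqP rk.
by apply: form_bias_rank_odd; rewrite ?tr_moment_mx ?rk.
Qed.

Definition weighted_bias (w : nat -> rat) m : rat := \sum_(r < m.+1) w r * rank_bias F m r.

(* Passing from m to m + 1 only changes the terms r = m and r = m + 1, one of
   which is zero by parity; the constant weight 1 determines the other. *)
Lemma weighted_biasS w m : (0 < m)%N -> weighted_bias w m.+1 =
  weighted_bias w m + (q%:R ^+ m - q%:R ^+ m.-1) * w (odd m + m)%N.
Proof.
(* The ranks below [m] cancel by [rank_bias_stable]. *)
move=> m0; have split v : weighted_bias v m.+1 - weighted_bias v m =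
    v m * (rank_bias F m.+1 m - rank_bias F m m) + v m.+1 * rank_bias F m.+1 m.+1.
  rewrite /weighted_bias 2!big_ord_recr [in X in _ - X]big_ord_recr /=.
  under eq_bigr => i _ do rewrite rank_bias_stable //.
  by ring.
rewrite -[LHS](subrK (weighted_bias w m)) addrC split; congr (_ + _).
have total k : (0 < k)%N -> weighted_bias (fun=> 1) k = q%:R ^+ k.-1.
  by move=> k0; rewrite -sum_rank_bias //; apply: eq_bigr => i _; rewrite mul1r.
have := split (fun=> 1); rewrite !total //= !mul1r => ->.
case: (boolP (odd m)) => [m1|m1]; rewrite ?add0n ?add1n.
  by rewrite !(rank_bias_odd _ m1) subr0 mulr0 !add0r mulrC.
by rewrite (rank_bias_odd _ (r := m.+1)) ?oddS // !mulr0 !addr0 mulrC.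
Qed.

Lemma weighted_bias1 w : weighted_bias w 1 = w 0%N.
Proof.
have := sum_rank_bias (ltn0Sn 0); rewrite /weighted_bias !big_ord_recl !big_ord0 /=.
by rewrite !(rank_bias_odd _ (r := 1)) // mulr0 !addr0 => ->; rewrite mulr1.
Qed.

Lemma num_solutions_weighted m k n (A : 'M[F]_n) : n = k.*2.+1 -> A^T = A ->
  A \in unitmx -> (num_solutions m A)%:R = q%:R ^+ (m * n) / q%:R ^+ (m + m).-1 *
     weighted_bias (fun r => q%:R ^- (k * r)) m.
Proof.
move=> nE symA uA; rewrite num_solutionsE; congr (_ * _).
rewrite /weighted_bias -(sum_by_rank F m (fun r => q%:R ^- (k * r))); apply: eq_bigr => s _.
by apply: form_bias_odd; rewrite ?tr_moment_mx.
Qed.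

End WeightedBias.

(** * Removing common factors *)

Section MonicGcd.
Variables (F : fieldType) (n : nat).
Implicit Types (x y : 'I_n -> {poly F}) (h : {poly F}).

(** Normalising the gcd makes the factorisation of a nonzero vector into gcd and coprime vector
    unique. *)
Definition monic_gcd x : {poly F} :=
  let d := \big[@gcdp F/0]_(i < n) x i in (lead_coef d)^-1 *: d.

Lemma coprime_vecE x : coprime_vec x = (\big[@gcdp F/0]_(i < n) x i %= 1).
Proof. by []. Qed.

Lemma big_gcdp_mul h x :
  \big[@gcdp F/0]_(i < n) (h * x i) %= h * \big[@gcdp F/0]_(i < n) x i.
Proof.
apply: (big_rec2 (fun d e => d %= h * e)); first by rewrite mulr0 eqpxx.
move=> i d e _ de; apply: eqp_trans (eqp_gcdr _ de) _.
by rewrite eqp_sym mulp_gcdr.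
Qed.

Lemma dvdp_big_gcdp x i : \big[@gcdp F/0]_(i < n) x i %| x i.
Proof.
elim: n x i => [x []//|k IHk x i]; rewrite big_ord_recl.
have [j ->|->] := unliftP ord0 i; last exact: dvdp_gcdl.
exact: dvdp_trans (dvdp_gcdr _ _) (IHk (fun i => x (lift ord0 i)) j).
Qed.

Lemma big_gcdp_eq0 x i : x i != 0 -> \big[@gcdp F/0]_(i < n) x i != 0.
Proof. by apply: contraNneq => d0; rewrite -dvd0p -d0 dvdp_big_gcdp. Qed.

Lemma monic_gcd_eqp x i : x i != 0 -> monic_gcd x %= \big[@gcdp F/0]_(i < n) x i.
Proof.
move=> xi; apply: eqp_scale; rewrite invr_neq0 // lead_coef_eq0.
exact: big_gcdp_eq0 xi.
Qed.

Lemma monic_gcd_monic x i : x i != 0 -> monic_gcd x \is monic.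
Proof.
move=> xi; rewrite monicE lead_coefZ mulVf // lead_coef_eq0.
exact: big_gcdp_eq0 xi.
Qed.

Lemma monic_gcd_dvd x i j : x i != 0 -> monic_gcd x %| x j.
Proof. by move=> xi; rewrite (eqp_dvdl _ (monic_gcd_eqp xi)) dvdp_big_gcdp. Qed.

Lemma monic_gcdK x i j : x i != 0 -> monic_gcd x * (x j %/ monic_gcd x) = x j.
Proof. by move=> xi; rewrite mulrC divpK // (monic_gcd_dvd _ xi). Qed.

Lemma coprime_div_gcd x i : x i != 0 -> coprime_vec (fun j => x j %/ monic_gcd x).
Proof.
move=> xi; have g0 := monic_neq0 (monic_gcd_monic xi).
rewrite coprime_vecE -(eqp_mul2l _ _ g0) mulr1 eqp_sym.
apply: eqp_trans (monic_gcd_eqp xi) _.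
rewrite -[X in X %= _](eq_bigr _ (fun j _ => monic_gcdK j xi)).
exact: big_gcdp_mul.
Qed.

Lemma monic_gcd_mul h x : h \is monic -> coprime_vec x -> monic_gcd (fun i => h * x i) = h.
Proof.
move=> mh cx; have h0 := monic_neq0 mh.
have e : \big[@gcdp F/0]_(i < n) (h * x i) %= h.
  apply: eqp_trans (big_gcdp_mul _ _) _.
  by rewrite -{2}[h]mulr1 eqp_mul2l.
have d0 : \big[@gcdp F/0]_(i < n) (h * x i) != 0 by rewrite -eqp0 (eqp_ltrans e) eqp0.
have md : monic_gcd (fun i => h * x i) \is monic.
  by rewrite monicE lead_coefZ mulVf // lead_coef_eq0.
apply/eqP; rewrite -eqp_monic //; apply: eqp_trans e.
by apply: eqp_scale; rewrite invr_neq0 // lead_coef_eq0.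
Qed.

Lemma coprime_vec_mul h x : coprime_vec x -> coprime_vec (fun i => h * x i) = (h %= 1).
Proof.
move=> cx; rewrite coprime_vecE (eqp_ltrans (big_gcdp_mul _ _)).
have /eqp_ltrans -> // : h * \big[@gcdp F/0]_(i < n) x i %= h.
by rewrite -{2}[h]mulr1 eqp_mull.
Qed.

Lemma max_size_mul h x : h != 0 ->
  (\max_(i < n) size (h * x i)%R =
   if \max_(i < n) size (x i) == 0 then 0 else (\max_(i < n) size (x i)) + (size h).-1)%N.
Proof.
move=> h0; pose f k := (if k == 0 then 0 else k + (size h).-1)%N.
rewrite -/(f _) (big_morph f (id1 := 0%N) (op1 := maxn)) //.
  apply: eq_bigr => i _; rewrite /f size_poly_eq0.
  case: eqP => [->|/eqP xi]; first by rewrite mulr0 size_poly0.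
  rewrite size_mul //; move: h0; rewrite -size_poly_gt0.
  by move: (size h) (size (x i)) => [] // k l; rewrite addSn addnC.
by move=> a b; rewrite /f; case: a b => [|a] [|b] //=; rewrite -addn_maxl maxnSS.
Qed.

Lemma qform_eval_mul (A : 'M[F]_n) h x :
  qform_eval A (fun i => h * x i) = h ^+ 2 * qform_eval A x.
Proof.
rewrite /qform_eval big_distrr; apply: eq_bigr => i _ /=.
by rewrite big_distrr; apply: eq_bigr => j _ /=; ring.
Qed.

Lemma eq_coprime_vec x y : x =1 y -> coprime_vec x = coprime_vec y.
Proof. by move=> xy; rewrite /coprime_vec (eq_bigr y). Qed.

Lemma eq_monic_gcd x y : x =1 y -> monic_gcd x = monic_gcd y.
Proof. by move=> xy; rewrite /monic_gcd (eq_bigr y). Qed.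

Lemma eq_qform_eval (A : 'M[F]_n) x y : x =1 y -> qform_eval A x = qform_eval A y.
Proof. by move=> xy; apply: eq_bigr => i _; apply: eq_bigr => j _; rewrite !xy. Qed.

End MonicGcd.

(** * From all solutions to those with coprime entries *)

Section PrimitiveSolutions.
Variable F : finFieldType.
Local Notation q := (#|F|).

Definition poly_vec m n (x : {ffun 'I_n -> {poly_m F}}) (i : 'I_n) : {poly F} := x i.

Definition bounded_vec m n (y : 'I_n -> {poly F}) : {ffun 'I_n -> {poly_m F}} :=
  [ffun i => npolyp m (y i)].

Lemma eq_poly_vec m n (x y : {ffun 'I_n -> {poly_m F}}) : poly_vec x =1 poly_vec y -> x = y.
Proof. by move=> xy; apply/ffunP => i; apply/val_inj/xy. Qed.

Lemma bounded_vecK m n (y : 'I_n -> {poly F}) : (forall i, size (y i) <= m)%N ->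
  poly_vec (bounded_vec m y) =1 y.
Proof. by move=> ym i; rewrite /poly_vec ffunE npolypK. Qed.

Definition max_size n (y : 'I_n -> {poly F}) := (\max_(i < n) size (y i))%N.

Lemma max_size_leP n (y : 'I_n -> {poly F}) m :
  reflect (forall i, size (y i) <= m)%N (max_size y <= m)%N.
Proof.
by apply: (iffP (bigmax_leqP _ _ _)) => h i; [exact: h | move=> _; exact: h].
Qed.

Lemma eq_max_size n (x y : 'I_n -> {poly F}) : x =1 y -> max_size x = max_size y.
Proof. by move=> xy; apply: eq_bigr => i _; rewrite xy. Qed.

Lemma max_size_gt0 n (y : 'I_n -> {poly F}) : (0 < max_size y)%N -> exists i, y i != 0.
Proof.
move=> y0; apply/existsP; apply: contraTT y0; rewrite negb_exists => /forallP y0.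
rewrite -leqNgt; apply/max_size_leP => i; move: (y0 i); rewrite negbK => /eqP->.
by rewrite size_poly0.
Qed.

Lemma max_size_poly_vec m n (x : {ffun 'I_n -> {poly_m F}}) : (max_size (poly_vec x) <= m)%N.
Proof. by apply/max_size_leP => i; exact: size_npoly. Qed.

Definition solutions m n (A : 'M[F]_n) : {set {ffun 'I_n -> {poly_m F}}} :=
  [set x | qform_eval A (poly_vec x) == 0].

Definition top_solutions m n (A : 'M[F]_n) : {set {ffun 'I_n -> {poly_m F}}} :=
  [set x | (max_size (poly_vec x) == m) && (qform_eval A (poly_vec x) == 0)].

Lemma card_solutions m n (A : 'M[F]_n) : #|solutions m A| = num_solutions m A.
Proof.
pose f (X : 'M[F]_(m, n)) : {ffun 'I_n -> {poly_m F}} := bounded_vec m (col_polys X).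
have fE X : poly_vec (f X) =1 col_polys X.
  by apply: bounded_vecK => i; apply: size_col_polys.
have f_inj : injective f.
  move=> X Y e; apply/matrixP => i j.
  have : col_polys X j = col_polys Y j by rewrite -!fE e.
  by move/(congr1 (fun p : {poly F} => p`_i)); rewrite !coef_rVpoly_ord !mxE.
rewrite /num_solutions -(card_imset _ f_inj); apply: eq_card => x.
rewrite inE; apply/idP/imsetP => [x0|[X + ->]]; last first.
  by rewrite inE (eq_qform_eval _ (fE X)).
have xE : col_polys (\matrix_(i, j) (poly_vec x j)`_i : 'M[F]_(m, n)) =1 poly_vec x.
  move=> j; apply/polyP => i; rewrite coef_rVpoly; case: insubP => [k _ <-|].
    by rewrite !mxE.
  by rewrite -leqNgt => mi; rewrite nth_default // (leq_trans _ mi) // size_npoly.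
exists (\matrix_(i, j) (poly_vec x j)`_i); last by apply: eq_poly_vec => i; rewrite fE xE.
by rewrite inE (eq_qform_eval _ xE).
Qed.

Lemma card_solutionsS m n (A : 'M[F]_n) :
  #|solutions m.+1 A| = (#|solutions m A| + #|top_solutions m.+1 A|)%N.
Proof.
rewrite -(cardsID (top_solutions m.+1 A)) addnC; congr (_ + _)%N; last first.
  by apply: eq_card => x; rewrite !inE andbC -andbA andbb.
pose f (x : {ffun 'I_n -> {poly_m F}}) := bounded_vec m.+1 (poly_vec x).
have fE x : poly_vec (f x) =1 poly_vec x.
  by apply: bounded_vecK => i; rewrite leqW // size_npoly.
have f_inj : injective f.
  by move=> x y e; apply: eq_poly_vec => i; rewrite -fE e fE.
rewrite -[RHS](card_imset _ f_inj); apply: eq_card => x.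
rewrite !inE; apply/andP/imsetP => [[+ x0]|[y + ->]]; last first.
  rewrite !inE (eq_qform_eval _ (fE y)) (eq_max_size (fE y)) => ->; rewrite andbT.
  by rewrite ltn_eqF // ltnS max_size_poly_vec.
rewrite x0 andbT => xm; have {}xm : (max_size (poly_vec x) <= m)%N.
  by rewrite -ltnS ltn_neqAle xm max_size_poly_vec.
have xE := bounded_vecK (max_size_leP _ _ xm).
exists (bounded_vec m (poly_vec x)); first by rewrite inE (eq_qform_eval _ xE).
by apply: eq_poly_vec => i; rewrite fE xE.
Qed.

Lemma monic_linear_ext (g : {poly F}) c : g \is monic ->
  ('X * g + c%:P) \is monic /\ size ('X * g + c%:P) = (size g).+1.
Proof.
move=> mg; have g0 := monic_neq0 mg; rewrite mulrC -cons_poly_def.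
have s : size (cons_poly c g) = (size g).+1 by rewrite size_cons_poly nil_poly (negPf g0).
split=> //; rewrite monicE lead_coefE s coef_cons /=.
by move: mg; rewrite monicE lead_coefE; case: (size g) (size_poly_gt0 g) => //; rewrite g0.
Qed.

Lemma in_mor_vectors m n (A : 'M[F]_n) x :
  (x \in mor_vectors A m) = (x \in top_solutions m.+1 A) && coprime_vec (poly_vec x).
Proof. by rewrite !inE andbC. Qed.

(* With g the monic gcd of z, the map (c, z) |-> (X g + c) (z / g) is a bijection
   from pairs with z of degree m - 1 to non-coprime vectors of degree m. *)
Lemma card_top_solutions m n (A : 'M[F]_n) : (0 < m)%N ->
  #|top_solutions m.+1 A| = (#|mor_vectors A m| + q * #|top_solutions m A|)%N.
Proof.
move=> m0.
rewrite -(cardsID (mor_vectors A m)); congr (_ + _)%N.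
  by apply: eq_card => x; rewrite in_setI in_mor_vectors andbA andbb.
pose g (z : {ffun 'I_n -> {poly_m F}}) := monic_gcd (poly_vec z).
pose y (z : {ffun 'I_n -> {poly_m F}}) i := poly_vec z i %/ g z.
pose h (t : F * {ffun 'I_n -> {poly_m F}}) := 'X * g t.2 + t.1%:P.
pose f (t : F * {ffun 'I_n -> {poly_m F}}) := bounded_vec m.+1 (fun i => h t * y t.2 i).
have topP z : z \in top_solutions m A -> exists i, poly_vec z i != 0.
  by rewrite inE => /andP[/eqP zm _]; apply: max_size_gt0; rewrite zm.
have zE z : z \in top_solutions m A -> poly_vec z =1 (fun i => g z * y z i).
  by move=> /topP[i zi] j; rewrite (monic_gcdK _ zi).
have cop z : z \in top_solutions m A -> coprime_vec (y z).
  by move=> /topP[i zi]; apply: coprime_div_gcd zi.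
have mg z : z \in top_solutions m A -> g z \is monic.
  by move=> /topP[i zi]; apply: monic_gcd_monic zi.
have mh c z : z \in top_solutions m A -> h (c, z) \is monic /\ size (h (c, z)) = (size (g z)).+1.
  by move=> /mg; apply: monic_linear_ext.
have top_size c z : z \in top_solutions m A ->
    max_size (fun i => h (c, z) * y z i) = m.+1.
  move=> zT; have [mhz sh] := mh c z zT; have g0 := monic_neq0 (mg z zT).
  move: (zT); rewrite inE => /andP[/eqP + _]; rewrite (eq_max_size (zE z zT)).
  rewrite /max_size max_size_mul // max_size_mul ?monic_neq0 // sh.
  move: g0; rewrite -size_poly_gt0; case: eqP => [_ _ e|_]; first by rewrite -e in m0.
  by case: (size (g z)) => // k _ /= <-; rewrite addnS.
have fE c z : z \in top_solutions m A -> poly_vec (f (c, z)) =1 (fun i => h (c, z) * y z i).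
  by move=> zT; apply/bounded_vecK/max_size_leP; rewrite top_size.
have qfE z : z \in top_solutions m A -> qform_eval A (y z) == 0.
  move=> zT; move: (zT); rewrite inE (eq_qform_eval _ (zE z zT)) qform_eval_mul.
  by rewrite mulf_eq0 expf_eq0 /= (negPf (monic_neq0 (mg z zT))) => /andP[].
rewrite -(cardsT F) -cardsX -(card_in_imset (f := f)); last first.
  case=> [c z] [c' z'] /setXP[_ zT] /setXP[_ zT'] e.
  have {e}e i : h (c, z) * y z i = h (c', z') * y z' i by rewrite -!fE // e.
  have [mhz _] := mh c z zT; have [mhz' _] := mh c' z' zT'.
  (* [h] is recovered as the monic gcd of the image; its constant coefficient is [c] and the rest is
     ['X * g]. *)
  have hE : h (c, z) = h (c', z').
    rewrite -(monic_gcd_mul mhz (cop z zT)) -(monic_gcd_mul mhz' (cop z' zT')).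
    exact: eq_monic_gcd.
  have cE : c = c'.
    have := congr1 (fun p : {poly F} => p`_0) hE.
    by rewrite !coefD !coefXM !coefC /= !add0r.
  congr (_, _) => //; apply: eq_poly_vec => i; rewrite (zE z zT) (zE z' zT').
  have gE : g z = g z'.
    by move: hE; rewrite /h /= cE => /addIr/mulfI-> //; rewrite polyX_eq0.
  by rewrite gE; congr (_ * _); apply: (mulfI (monic_neq0 mhz)); rewrite e hE.
apply: eq_card => x; apply/setDP/imsetP => [[xT xN]|[[c z] + ->]]; last first.
  move=> /setXP[_ zT']; rewrite in_mor_vectors inE.
  have [mhz sh] := mh c z zT'; rewrite (eq_max_size (fE c z zT')) top_size // eqxx.
  rewrite (eq_qform_eval _ (fE c z zT')) qform_eval_mul (eqP (qfE z zT')) mulr0 eqxx.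
  rewrite (eq_coprime_vec (fE c z zT')) coprime_vec_mul ?cop // -size_poly_eq1 sh.
  by split; rewrite // eqSS size_poly_eq0 (monic_neq0 (mg z zT')).
move: (xT); rewrite inE => /andP[/eqP xm xq].
have [i xi] : exists i, poly_vec x i != 0 by apply: max_size_gt0; rewrite xm.
pose G := monic_gcd (poly_vec x); pose Y j := poly_vec x j %/ G.
have mG : G \is monic := monic_gcd_monic xi.
have xE : poly_vec x =1 (fun j => G * Y j) by move=> j; rewrite (monic_gcdK _ xi).
have cY : coprime_vec Y := coprime_div_gcd xi.
(* Failure of coprimality makes [G] nonconstant, so its degree can be lowered. *)
have sG : (1 < size G)%N.
  move: xN; rewrite in_mor_vectors xT /= (eq_coprime_vec xE) coprime_vec_mul // -size_poly_eq1.
  by have := monic_neq0 mG; rewrite -size_poly_gt0; case: (size G) => [|[]].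
(* The preimage replaces [G] by its quotient by ['X] and remembers the constant coefficient as
   [c]. *)
pose g' := drop_poly 1 G.
have GE : 'X * g' + (G`_0)%:P = G.
  apply/polyP => -[|k]; rewrite coefD coefXM coefC /= ?add0r // addr0.
  by rewrite coef_drop_poly addn1.
have sg' : size g' = (size G).-1 by rewrite size_drop_poly subn1.
have mg' : g' \is monic.
  move: mG; rewrite !monicE !lead_coefE sg' coef_drop_poly addn1.
  by case: (size G) sG => [|[]].
have zm : max_size (fun j => g' * Y j) = m.
  move: xm; rewrite (eq_max_size xE) /max_size max_size_mul ?monic_neq0 //.
  rewrite max_size_mul ?monic_neq0 // sg'; case: eqP => // _.
  by case: (size G) sG => [|[|k]] //= _; rewrite addnS => -[].
pose z := bounded_vec m (fun j => g' * Y j).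
have zvE : poly_vec z =1 (fun j => g' * Y j).
  by apply/bounded_vecK/max_size_leP; rewrite zm.
have zT : z \in top_solutions m A.
  rewrite inE (eq_max_size zvE) zm eqxx (eq_qform_eval _ zvE) qform_eval_mul mulf_eq0.
  move: xq; rewrite (eq_qform_eval _ xE) qform_eval_mul mulf_eq0 expf_eq0 /=.
  by rewrite (negPf (monic_neq0 mG)) => /= ->; rewrite orbT.
have gz : g z = g' by rewrite /g (eq_monic_gcd zvE) monic_gcd_mul.
exists (G`_0, z); first by rewrite in_setX inE.
apply: eq_poly_vec => j; rewrite fE // xE /h /= gz GE /y zvE gz mulrC.
by rewrite mulrC mulKp ?monic_neq0.
Qed.

End PrimitiveSolutions.

(** * Conclusion *)

Section SolutionCount.
Variable F : finFieldType.
Local Notation q := (#|F|).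
Hypothesis q_odd : odd q.
#[local] Hint Resolve qr_neq0 qr1_neq0 : core.

Lemma num_solutions0 n (A : 'M[F]_n) : num_solutions 0 A = 1%N.
Proof.
rewrite /num_solutions (_ : [set X | _] = setT) ?cardsT ?card_mx //.
apply/setP => X; rewrite !inE; apply/eqP/big1 => i _; apply: big1 => j _.
suff -> : col_polys X i = 0 by rewrite !mul0r.
by apply/eqP; rewrite -size_poly_leq0 size_col_polys.
Qed.

(** Combines [weighted_biasS] with the ratio [q^(n - 2)] of the normalising factors for [m.+1] and
    [m]. *)
Lemma num_solutionsS m k (A : 'M[F]_(k.*2.+1)) : (0 < k)%N -> A^T = A -> A \in unitmx ->
  (num_solutions m.+1 A)%:R = q%:R ^+ (k.*2).-1 *
    ((num_solutions m A)%:R + (q%:R - 1) * q%:R ^+ (k * (m./2).*2)) :> rat.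
Proof.
move=> k0 symA uA; rewrite (num_solutions_weighted q_odd _ (erefl _) symA uA).
have q0 : q%:R != 0 :> rat by [].
have ratio a b c d : (a + c = b + d)%N -> q%:R ^+ a / q%:R ^+ b = q%:R ^+ d / q%:R ^+ c :> rat.
  by move=> e; apply/eqP; rewrite eqr_div ?expf_neq0 // -!exprD e addnC.
(* [weighted_biasS] starts at 1, so the step from 0 to 1 is computed directly. *)
case: m => [|m].
  rewrite num_solutions0 weighted_bias1 //= muln0 expr0 invr1 !mulr1 mul1n.
  rewrite (ratio _ _ 0%N k.*2) ?addn0 // expr0 divr1 addrCA subrr addr0 -exprSr.
  by rewrite prednK ?double_gt0.
rewrite (num_solutions_weighted q_odd _ (erefl _) symA uA) weighted_biasS //.
set T := weighted_bias _ _; set D := (X in _ = _ * (X * _ + _)).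
rewrite (_ : _ / _ = q%:R ^+ (k.*2).-1 * D); last first.
  rewrite /D mulrA -exprD; apply: ratio; nia.
rewrite -mulrA mulrDr; congr (_ * (_ + _)).
transitivity ((q%:R - 1) * (D * q%:R ^+ m / q%:R ^+ (k * (odd m.+1 + m.+1)))).
  by rewrite exprS /=; ring.
congr (_ * _).
(* With [M = m.+1], the exponent is [2kM - k (M + odd M)], which equals [k] times the even part
   [(M./2).*2]. *)
rewrite /D -[LHS]mulrA mulrACA -invfM -!exprD -[RHS]divr1 -[in RHS](expr0 q%:R).
by apply: ratio; have := odd_double_half m.+1; nia.
Qed.

(** Solutions of exact maximal degree are first differences of [num_solutions]; [card_top_solutions]
    then removes the noncoprime ones, [q] times the count one degree lower. *)
Lemma num_morE n (A : 'M[F]_n) P : (0 < P)%N ->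
  num_mor A P = ((num_solutions P.+1 A)%:R - (num_solutions P A)%:R
    - q%:R * ((num_solutions P A)%:R - (num_solutions P.-1 A)%:R)) / (q%:R - 1).
Proof.
case: P => // p _; rewrite /num_mor natrB ?(ltnW (finNzRing_gt1 F)) //; congr (_ / _).
rewrite -!card_solutions !card_solutionsS (card_top_solutions (m := p.+1)) //.
by rewrite !natrD natrM; ring.
Qed.

End SolutionCount.

(** * The recurrence, with [y] standing for [q^(n-2)] and [K] for [q^((n-1)/2)] *)

Section Recurrence.
Variables (R : fieldType) (q y K : R) (N : nat -> R).
Hypotheses (q0 : q != 0) (q1 : q - 1 != 0).
Hypothesis N0 : N 0 = 1.
Hypothesis NS : forall m, N m.+1 = y * (N m + (q - 1) * K ^+ (m./2).*2).

(** The case [n = 3], where [q - y = 0] rules out the closed form below. As [y = q], all values of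
    [N] cancel and only the inhomogeneous terms remain. *)
Lemma recurrence_degenerate p : y = q -> K = q ->
  (N p.+2 - N p.+1 - q * (N p.+1 - N p)) / (q - 1) =
  if odd p then (q ^+ 2 - 1) / q * q ^+ p.+1 else 0.
Proof.
move=> yq Kq; set b := q ^+ (p./2).*2.
have halfS : q ^+ (p.+1./2).*2 = if odd p then q ^+ 2 * b else b.
  by rewrite -uphalfE uphalf_half /b; case: (odd p); rewrite ?add0n // add1n doubleS -exprD.
have pE : q ^+ p = if odd p then q * b else b.
  by rewrite -{1}(odd_double_half p) exprD /b; case: (odd p); rewrite ?expr1 // mul1r.
rewrite !NS yq Kq halfS -/b [q ^+ p.+1]exprS pE.
by case: (odd p); field; rewrite ?q0 ?q1.
Qed.

Hypotheses (y0 : y != 0) (K0 : K != 0) (qy : q - y != 0) (K2 : K ^+ 2 = q * y).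

(** A homogeneous solution [y^m] plus a particular one proportional to [K^m]. Only even indices are
    needed, as one or two further steps of [NS] reach the others. *)
Lemma recurrence_double j :
  N j.*2 = ((1 - K ^+ 2) * y ^+ j.*2 + (q - 1) * (y + 1) * K ^+ j.*2) / (q - y).
Proof.
elim: j => [|j IHj]; first by rewrite N0 K2; field.
have KS : K ^+ (j.*2).+2 = q * y * K ^+ j.*2 by rewrite 2!exprS mulrA -expr2 K2.
rewrite doubleS !NS IHj /= uphalf_double doubleK KS K2 !exprS.
by field.
Qed.

Lemma recurrence_generic p :
  (N p.+2 - N p.+1 - q * (N p.+1 - N p)) / (q - 1) =
  (K ^+ 2 - 1) * (y - 1) / (y * (q - 1)) * y ^+ p.+1 -
  (if odd p then 0 else (K ^+ 2 - 1) / K * K ^+ p.+1).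
Proof.
rewrite -(odd_double_half p) oddD odd_double addbF oddb.
move: (odd p) (p./2) => b j.
have KS : K ^+ (j.*2).+2 = q * y * K ^+ j.*2 by rewrite 2!exprS mulrA -expr2 K2.
have Nd := recurrence_double j.
case: b; rewrite ?add0n ?add1n.
  rewrite !NS /= uphalf_double doubleK doubleS KS Nd K2 !exprS.
  by field; rewrite ?q0 ?q1 ?y0 ?K0.
rewrite !NS /= uphalf_double doubleK Nd K2 !exprS.
by field; rewrite ?q0 ?q1 ?y0 ?K0.
Qed.
End Recurrence.

Theorem theorem1p3 (F : finFieldType) (n : nat) (A : 'M[F]_n) (P : nat) :
  odd #|F| -> odd n -> (3 <= n)%N ->
  A^T = A -> \det A != 0 -> (1 <= P)%N ->
  let q : rat := (#|F|)%:R in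
  num_mor A P =
    if n == 3%N then
      (if ~~ odd P then (q ^+ 2 - 1) / q * q ^+ P else 0)
    else
      let c := (q ^+ n.-1 - 1) * (q ^+ (n - 2) - 1) / (q ^+ (n - 2) * (q - 1)) in
      (if ~~ odd P then c * q ^+ (P * (n - 2))
       else c * q ^+ (P * (n - 2))
            - (q ^+ n.-1 - 1) / q ^+ (n.-1./2) * q ^+ (n.-1./2 * P)).
Proof.
move=> q_odd n_odd n3 symA detA P0 q.
have uA : A \in unitmx by rewrite unitmxE unitfE.
have [k nE] : exists k, n = k.*2.+1 by exists n./2; rewrite -[LHS]odd_double_half n_odd.
subst n; have k0 : (0 < k)%N by rewrite -double_gt0 -ltnS ltnW.
have NS m := num_solutionsS q_odd m k0 symA uA.
have q0 : q != 0 := qr_neq0 F.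
have q1 : q - 1 != 0 := qr1_neq0 F.
rewrite num_morE //; case: P P0 => // p _; rewrite -/q /=.
have {}NS m : (num_solutions m.+1 A)%:R = q ^+ (k.*2).-1 *
    ((num_solutions m A)%:R + (q - 1) * (q ^+ k) ^+ (m./2).*2) by rewrite -exprM.
have N0 : (num_solutions 0 A)%:R = 1 :> rat by rewrite num_solutions0.
rewrite doubleK subSS subn1 (_ : (k.*2.+1 == 3)%N = (k == 1)%N); last first.
  by rewrite eqSS -[2%N]/(1.*2)%N (inj_eq double_inj).
case: eqP => [k1|/eqP k1].
  (* Here [P = p.+1], so [P] is even exactly when [p] is odd. *)
  by rewrite (recurrence_degenerate (N := fun m => (num_solutions m A)%:R) q0 q1 NS) ?k1 // negbK.
rewrite (recurrence_generic (N := fun m => (num_solutions m A)%:R) q1 N0 NS).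
- rewrite -!exprM (muln2 k) (mulnC p.+1).
  by case: (odd p); rewrite /= ?subr0.
- by rewrite expf_neq0.
- by rewrite expf_neq0.
(* [q] differs from [y = q^(2k - 1)] because [k] is not 1. *)
- rewrite subr_eq0 -{1}[q]expr1 -!natrX eqr_nat eqn_exp2l ?finNzRing_gt1 //.
  by case: k k1 k0 {A symA detA uA n_odd n3 NS N0} => [|[|]].
- by rewrite -exprM -exprS muln2 prednK ?double_gt0.
Qed.
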